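(* The set $\mathfrak{G}=\{\gamma_a\colon a\in L_\infty(\mathbb{R}_+)\}$ is a dense subset of $\operatorname{RO}(\mathbb{Z}_+)$ with respect to the supremum norm $\|\cdot\|_\infty$.
   Context: $\mathbb{Z}_+=\{0,1,2,\ldots\}$, $\mathbb{R}_+$ is the positive half-line with Lebesgue measure, functions and sequences are complex-valued. For $a\in L_\infty(\mathbb{R}_+)$ the sequence $\gamma_a\colon\mathbb{Z}_+\to\mathbb{C}$ is defined by $$\gamma_a(n)=\frac{1}{n!}\int_{\mathbb{R}_+}a(\sqrt{r})\,e^{-r}r^n\,dr,\qquad n\in\mathbb{Z}_+.$$ (This is the sequence of eigenvalues, in the basis $z^n/\sqrt{n!}$, of the Toeplitz operator on the Fock space $\mathcal{F}^2(\mathbb{C})$ with radial symbol $\varphi(z)=a(|z|)$.) Let $\rho(m,n)=|\sqrt{m}-\sqrt{n}|$ for $m,n\in\mathbb{Z}_+$. For a sequence $\sigma\colon\mathbb{Z}_+\to\mathbb{C}$ and $\delta\ge 0$ put $\omega_{\rho,\sigma}(\delta)=\sup\{|\sigma(n)-\sigma(m)|\colon m,n\in\mathbb{Z}_+,\ \rho(m,n)\le\delta\}$. Then $\operatorname{RO}(\mathbb{Z}_+)=\{\sigma\in\ell_\infty(\mathbb{Z}_+)\colon \lim_{\delta\to0}\omega_{\rho,\sigma}(\delta)=0\}$, i.e. the bounded sequences uniformly continuous with respect to $\rho$. *)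

(* Defs.v *)
From HB Require Import structures.
From mathcomp Require Export all_boot all_order all_algebra.
From mathcomp Require Export complex.
From mathcomp Require Export all_classical all_reals all_analysis.
Export numFieldNormedType.Exports.

Set Implicit Arguments.
Unset Strict Implicit.
Unset Printing Implicit Defensive.

Import Order.TTheory GRing.Theory Num.Theory.

Local Open Scope classical_set_scope.
Local Open Scope ring_scope.
Local Open Scope complex_scope.

(* real-closed has no measurable or normed structure over R on R[i]: integrals
   are taken componentwise and the modulus is the R-valued [normc]. *)
Notation modulus := ComplexField.Normc.normc.

Definition Rplus (R : realType) : set R := `[0, +oo[.

(* Elements are Borel representatives of the classes of L_oo(R_+); values on
   the negative half-line are irrelevant. *)
Definition Linfty (R : realType) : set (R -> R[i]) :=
  [set a : R -> R[i] | [/\ measurable_fun (@Rplus R) (fun r : R => complex.Re (a r)),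
               measurable_fun (@Rplus R) (fun r : R => complex.Im (a r)) &
               exists M : R, {ae (@lebesgue_measure R),
                 forall r : R, @Rplus R r -> modulus (a r) <= M}]].

Definition cintegral (R : realType) (D : set R) (f : R -> R[i]) : R[i] :=
  Rintegral (@lebesgue_measure R) D (fun r => complex.Re (f r)) +i*
  Rintegral (@lebesgue_measure R) D (fun r => complex.Im (f r)).

Definition gamma_seq (R : realType) (a : R -> R[i]) (n : nat) : R[i] :=
  (n`!%:R)^-1 *
  cintegral (@Rplus R) (fun r => a (Num.sqrt r) * (expR (- r) * r ^+ n)%:C).

Definition frakG (R : realType) : set (nat -> R[i]) :=
  [set gamma_seq a | a in @Linfty R].

Definition rho (R : realType) (m n : nat) : R :=
  `|Num.sqrt m%:R - Num.sqrt n%:R|.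

Definition omega (R : realType) (sigma : nat -> R[i]) (delta : R) : \bar R :=
  ereal_sup [set (modulus (sigma p.2 - sigma p.1))%:E
            | p in [set p : nat * nat | rho R p.1 p.2 <= delta]].

Definition sup_norm (R : realType) (sigma : nat -> R[i]) : \bar R :=
  ereal_sup [set (modulus (sigma n))%:E | n in [set: nat]].

Definition RO (R : realType) : set (nat -> R[i]) :=
  [set sigma | (sup_norm sigma < +oo)%E /\
               omega sigma delta @[delta --> 0^'+] --> 0%E].

Definition sup_dense_subset (R : realType) (A B : set (nat -> R[i])) : Prop :=
  A `<=` B /\
  forall sigma, B sigma -> forall eps : R, 0 < eps ->
    exists2 tau, A tau & (sup_norm (fun n => (sigma n - tau n)%R) < eps%:E)%E.

(* Main.v *)
Require Import Defs.
From mathcomp Require Import measurable_realfun.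
From mathcomp Require Import ring lra.

(** Put the birth-death generator [L f n = (n+1)(f (n+1) - f n) - n (f n - f (n-1))]
    on bounded sequences; it is the image, under [a |-> gamma_a], of the
    radial Laplacian. The semigroup [exp (t L)] has an explicit kernel: binomial
    thinning followed by a negative binomial birth step, with parameter
    [p = t / (1 + t)].
    At time 1 it factors as [exp L g = gamma_a] with [a (x) = sum_m g m exp(-x^2) x^(2m) / m!],
    so its range consists of sequences [gamma_a].
    The kernel satisfies [||exp (t L) - exp (s L)|| <= (t - s) / s] for [s < t <= 1],
    i.e. the semigroup is analytic. Hence, with [X = exp (h L)], expanding
    [(X + (1 - X))^(2 k)] and letting [k] grow with [k h] fixed shows that the range at
    a time [s] is in the closure of the range at time [17 s / 16], and, iterating, of
    the range at time 1. Finally [exp (t L) f -> f] uniformly as [t -> 0] when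
    [f] is uniformly continuous for [rho], because a step of the process moves
    [sqrt n] by [O (sqrt t)] in mean square.

    For the inclusion, [|gamma_a (n+1) - gamma_a n| <= ||a|| / sqrt (n+1)] (Cauchy-Schwarz
    against the Gamma density), so [gamma_a] is Lipschitz for [rho]. *)

Import Order.TTheory GRing.Theory Num.Theory.
Set Implicit Arguments.
Unset Strict Implicit.
Unset Printing Implicit Defensive.
Local Open Scope classical_set_scope.
Local Open Scope ring_scope.
Local Open Scope complex_scope.

(** * Averages of bounded sequences *)

Section Mean.
Context {R : realType}.
Implicit Types (w f g : nat -> R) (C : R).

Definition bounded_by C f := forall n, `|f n| <= C.

Definition weight w := (forall m, 0 <= w m) /\ series w @ \oo --> (1 : R).

(** The limit is meaningful once the series converges, which [mean_cvg] provides for a weight and a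
    bounded sequence. *)
Definition mean w f : R := limn (series (fun m => w m * f m)).

Lemma bounded_by_ge0 C f : bounded_by C f -> 0 <= C.
Proof. by move=> /(_ 0%N); exact: le_trans. Qed.

Lemma cvgn_le (u : nat -> R) l z :
  u @ \oo --> l -> (forall n, u n <= z) -> l <= z.
Proof.
move=> ul uz; rewrite -(cvg_lim _ ul)//; apply: limr_le; last exact: nearW.
by apply/cvg_ex; exists l.
Qed.

Lemma cvgn_norm_le (u : nat -> R) l z :
  u @ \oo --> l -> (forall n, `|u n| <= z) -> `|l| <= z.
Proof. by move=> /cvg_norm ul uz; exact: cvgn_le ul uz. Qed.

Lemma cvgn_sum (I : Type) (r : seq I) (u : I -> nat -> R) (l : I -> R) :
  (forall i, u i @ \oo --> l i) ->
  (fun n => \sum_(i <- r) u i n) @ \oo --> \sum_(i <- r) l i.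
Proof.
move=> ul; elim: r => [|i r IHr].
  by under eq_fun do rewrite big_nil; rewrite big_nil; exact: cvg_cst.
by under eq_fun do rewrite big_cons; rewrite big_cons; exact: cvgD.
Qed.

Lemma nonneg_series_le (u : nat -> R) l N :
  (forall m, 0 <= u m) -> series u @ \oo --> l -> \sum_(0 <= m < N) u m <= l.
Proof.
move=> u0 ul.
have h : nondecreasing_seq (series u).
  by apply/nondecreasing_seqP => n; rewrite /series/= big_nat_recr//= lerDl.
have cu : cvgn (series u) by apply/cvg_ex; exists l.
by rewrite -(cvg_lim _ ul)//; exact: (nondecreasing_cvgn_le h cu N).
Qed.

Lemma mean_cvg w f C : weight w -> bounded_by C f ->
  series (fun m => w m * f m) @ \oo --> mean w f.
Proof.
move=> [w0 w1] fC; apply: normed_cvg.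
apply: (@series_le_cvg _ _ (fun m => C * w m)) => [m|m|m|].
- exact: normr_ge0.
- by rewrite mulr_ge0// (bounded_by_ge0 fC).
- by rewrite /= normrM (ger0_norm (w0 m)) mulrC ler_wpM2r.
- have -> : series (fun m => C * w m) = (fun n => C * series w n).
    by apply/funext => n; rewrite /series/= mulr_sumr.
  by apply/cvg_ex; exists (C * 1); apply: cvgMl_tmp.
Qed.

Lemma mean_eq w f l :
  series (fun m => w m * f m) @ \oo --> l -> mean w f = l.
Proof. by move=> h; apply/cvg_lim. Qed.

Lemma meanD w f g C D : weight w -> bounded_by C f -> bounded_by D g ->
  mean w (f \+ g) = mean w f + mean w g.
Proof.
move=> ww fC gD; apply: mean_eq.
have -> : series (fun m => w m * (f \+ g) m) =
   series (fun m => w m * f m) \+ series (fun m => w m * g m).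
  apply/funext => n; rewrite /series/= -big_split/=.
  by apply: eq_bigr => i _; rewrite mulrDr.
by apply: cvgD; [apply: mean_cvg fC|apply: mean_cvg gD].
Qed.

Lemma meanZ w f a C : weight w -> bounded_by C f ->
  mean w (a \*o f) = a * mean w f.
Proof.
move=> ww fC; apply: mean_eq.
have -> : series (fun m => w m * (a \*o f) m) =
   (fun n => a * series (fun m => w m * f m) n).
  apply/funext => n; rewrite /series/= mulr_sumr.
  by apply: eq_bigr => i _; rewrite /= mulrCA.
by apply: cvgMl_tmp; apply: mean_cvg fC.
Qed.

Lemma meanB w f g C D : weight w -> bounded_by C f -> bounded_by D g ->
  mean w (f \- g) = mean w f - mean w g.
Proof.
move=> ww fC gD.
have -> : f \- g = f \+ ((-1) \*o g).
  by apply/funext => n /=; rewrite mulN1r.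
rewrite (meanD (C := C) (D := D) ww fC) => [|n /=].
  by rewrite (meanZ _ ww gD) mulN1r.
by rewrite mulN1r normrN.
Qed.

Lemma weight_sum_le1 w N : weight w -> \sum_(0 <= m < N) w m <= 1.
Proof. by case; exact: nonneg_series_le. Qed.

Lemma mean_norm w f C : weight w -> bounded_by C f -> `|mean w f| <= C.
Proof.
move=> ww fC; have C0 := bounded_by_ge0 fC.
apply: (cvgn_norm_le (mean_cvg ww fC)) => n; rewrite /series/=.
apply: le_trans (ler_norm_sum _ _ _) _.
apply: (@le_trans _ _ (\sum_(0 <= m < n) w m * C)).
  by apply: ler_sum => m _; rewrite normrM (ger0_norm (ww.1 m)) ler_wpM2l ?ww.1.
by rewrite -mulr_suml ler_piMl// weight_sum_le1.
Qed.

Lemma mean_const w c : weight w -> mean w (fun=> c) = c.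
Proof.
move=> [w0 w1]; apply: mean_eq.
have -> : series (fun m => w m * c) = (fun n => c * series w n).
  by apply/funext => n; rewrite /series/= mulr_sumr; apply: eq_bigr => i _; rewrite mulrC.
by rewrite -[X in _ --> X]mulr1; apply: cvgMl_tmp.
Qed.

(** Dominated convergence for weighted series: beyond some [N] the remaining mass of [w], times [C],
    is at most [e / 2], and the head is a finite sum of null sequences. *)
Lemma mean_tannery w (f_ : nat -> nat -> R) C : weight w ->
  (forall r, bounded_by C (f_ r)) -> (forall m, f_ ^~ m @ \oo --> (0 : R)) ->
  (fun r => mean w (f_ r)) @ \oo --> (0 : R).
Proof.
move=> ww fC f0; have C0 := bounded_by_ge0 (fC 0%N).
apply/cvgr0Pnorm_le => e e0.
have [N _ hN] : \forall N \near \oo, (C * (1 - series w N)) <= e / 2.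
  have h : (fun N => C * (1 - series w N)) @ \oo --> (0 : R).
    rewrite -[X in _ --> X](mulr0 C); apply: cvgMl_tmp.
    by rewrite -(subrr 1); apply: cvgB ww.2; exact: cvg_cst.
  by apply: (cvgr_le _ h); rewrite divr_gt0.
have {}hN := hN N (leqnn N).
have h : (fun r => \sum_(0 <= m < N) w m * `|f_ r m|) @ \oo --> (0 : R).
  have := @cvgn_sum _ (index_iota 0 N) (fun m r => w m * `|f_ r m|) (fun=> 0).
  rewrite big1//; apply=> m; rewrite -[X in _ --> X](mulr0 (w m)).
  by apply: cvgMl_tmp; rewrite -(normr0 R); apply: cvg_norm; exact: f0.
near=> r.
have hr : \sum_(0 <= m < N) w m * `|f_ r m| <= e / 2.
  near: r; apply: (cvgr_le _ h); by rewrite divr_gt0.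
apply: (cvgn_norm_le (mean_cvg ww (fC r))) => n.
apply: le_trans (ler_norm_sum _ _ _) _.
under eq_bigr do rewrite normrM (ger0_norm (ww.1 _)).
have pos m : 0 <= w m * `|f_ r m| by rewrite mulr_ge0// ww.1.
(* Enlarging the range from [n] to [N + n] allows a cut at [N] without comparing [n] with [N]. *)
apply: (@le_trans _ _ (\sum_(0 <= m < N + n) w m * `|f_ r m|)).
  rewrite (@big_cat_nat _ _ _ n 0 (N + n)) ?leq_addl//=.
  by rewrite lerDl; apply: sumr_ge0.
rewrite (@big_cat_nat _ _ _ N 0 (N + n)) ?leq_addr//= [leRHS]splitr lerD//.
apply: le_trans hN.
apply: (@le_trans _ _ (\sum_(N <= m < N + n) w m * C)).
  by apply: ler_sum => m _; rewrite ler_wpM2l ?ww.1// fC.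
rewrite -mulr_suml mulrC ler_wpM2l// lerBrDl.
have := weight_sum_le1 (N + n) ww.
by rewrite (@big_cat_nat _ _ _ N 0 (N + n)) ?leq_addr.
Unshelve. all: by end_near. Qed.

End Mean.

(** * The birth-death kernel *)

Section Kernel.
Context {R : realType}.
Implicit Types (p z : R) (k n m : nat).

(** A bounded monotone sequence converges, and its limit must solve [x = l + z * x]. The partial
    sums of the negative binomial series obey such a recursion. *)
Lemma affine_rec_cvg (x b : nat -> R) z l : 0 <= z < 1 ->
  nondecreasing_seq x -> (forall N, x N.+1 = b N + z * x N) ->
  (forall N, b N <= l) -> b @ \oo --> l -> x @ \oo --> l / (1 - z).
Proof.
move=> /andP[z0 z1] xnd xS bl cb.
have z1' : 0 < 1 - z by rewrite subr_gt0.
have xb N : x N <= l / (1 - z).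
  rewrite ler_pdivlMr//; have := xnd N N.+1 (leqnSn N); have := bl N.
  rewrite xS; lra.
have cx : cvgn x.
  apply: nondecreasing_is_cvgn => //; exists (l / (1 - z)) => _ [N _ <-]; exact: xb.
have cxS : x \o succn @ \oo --> limn x by rewrite cvg_shiftS.
have cxS' : x \o succn @ \oo --> l + z * limn x.
  have -> : x \o succn = b \+ (fun N => z * x N) by apply/funext => N /=; rewrite xS.
  by apply: cvgD => //; apply: cvgMl_tmp.
have e : limn x = l + z * limn x by exact: (@cvg_unique _ _ (x \o succn @ \oo)).
suff -> : l / (1 - z) = limn x by [].
by apply: (mulIf (lt0r_neq0 z1')); rewrite divfK ?lt0r_neq0//; lra.
Qed.

Lemma negative_binomial_series z k : 0 <= z < 1 ->
  series (fun m => 'C(m, k)%:R * z ^+ (m - k)) @ \oo --> ((1 - z) ^+ k.+1)^-1.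
Proof.
move=> /[dup] zz /andP[z0 z1].
have u0 k' m : 0 <= 'C(m, k')%:R * z ^+ (m - k') by rewrite mulr_ge0// exprn_ge0.
have nd k' : nondecreasing_seq (series (fun m => 'C(m, k')%:R * z ^+ (m - k'))).
  by apply/nondecreasing_seqP => N; rewrite /series/= big_nat_recr//= lerDl.
elim: k => [|k IHk].
  rewrite expr1 -div1r; apply: (@affine_rec_cvg _ (fun=> 1)) => //; last exact: cvg_cst.
  move=> N; rewrite /series/= big_nat_recl//= bin0 expr0 mulr1 mulr_sumr.
  by congr (_ + _); apply: eq_bigr => m _; rewrite !bin0 !mul1r !subn0 exprS.
rewrite exprSr invfM.
apply: (@affine_rec_cvg _ (series (fun m => 'C(m, k)%:R * z ^+ (m - k)))) => //.
(* Pascal's rule gives [S_(k+1) (N+1) = S_k N + z * S_(k+1) N] for the partial sums, the term at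
   [m = 0] being zero. *)
- move=> N; rewrite /series/= big_nat_recl//= bin0n mul0r add0r mulr_sumr -big_split/=.
  apply: eq_bigr => m _; rewrite binS subSS natrD mulrDl addrC; congr (_ + _).
  have [km|mk] := ltnP k m; last by rewrite bin_small ?mul0r ?mulr0.
  by rewrite mulrCA -exprS -subnSK.
- by move=> N; exact: nonneg_series_le.
Qed.

(** Thinning: the law of the number of survivors among [n] when each survives with probability
    [1 - p]. *)
Definition binw p n k : R := 'C(n, k)%:R * (1 - p) ^+ k * p ^+ (n - k).

(** Birth: [m - k] counts the failures before success number [k.+1] in trials of success probability
    [1 - p]. *)
Definition negb p k m : R := 'C(m, k)%:R * (1 - p) ^+ k.+1 * p ^+ (m - k).

Definition kern p n m : R := \sum_(k < n.+1) binw p n k * negb p k m.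

Lemma binw_ge0 p n k : 0 < p < 1 -> 0 <= binw p n k.
Proof. by move=> /andP[p0 p1]; rewrite !mulr_ge0// exprn_ge0; lra. Qed.

Lemma negb_ge0 p k m : 0 < p < 1 -> 0 <= negb p k m.
Proof. by move=> /andP[p0 p1]; rewrite !mulr_ge0// exprn_ge0; lra. Qed.

Lemma kern_ge0 p n m : 0 < p < 1 -> 0 <= kern p n m.
Proof. by move=> pp; apply: sumr_ge0 => k _; rewrite mulr_ge0 ?binw_ge0 ?negb_ge0. Qed.

Lemma binw_gen p n z : \sum_(k < n.+1) binw p n k * z ^+ k = (p + (1 - p) * z) ^+ n.
Proof.
rewrite exprDn; apply: eq_bigr => k _; rewrite /binw exprMn -mulr_natl; ring.
Qed.

Lemma binw_sum p n : \sum_(k < n.+1) binw p n k = 1.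
Proof.
have := binw_gen p n 1; rewrite mulr1 addrC subrK expr1n => <-.
by apply: eq_bigr => k _; rewrite expr1n mulr1.
Qed.

(** Size biasing, from [k * 'C(n.+1, k) = n.+1 * 'C(n, k.-1)]. It lowers the degree of moments and,
    read backwards, handles [1 / k.+1]. *)
Lemma binw_shift p n (g : nat -> R) :
  \sum_(k < n.+2) binw p n.+1 k * (k%:R * g k.-1) =
  n.+1%:R * (1 - p) * \sum_(k < n.+1) binw p n k * g k.
Proof.
rewrite big_ord_recl mul0r mulr0 add0r mulr_sumr; apply: eq_bigr => k _.
rewrite /binw lift0 /= subSS.
transitivity ((k.+1 * 'C(n.+1, k.+1))%:R * (1 - p) ^+ k.+1 * p ^+ (n - k) * g k).
  by rewrite natrM; ring.
by rewrite -mul_bin_diag natrM exprS /=; ring.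
Qed.

Lemma binw_moment p n (a b c : R) :
  \sum_(k < n.+1) binw p n k * (a + b * k%:R + c * k%:R ^+ 2) =
  a + b * (n%:R * (1 - p)) + c * (n%:R * (1 - p) * p + (n%:R * (1 - p)) ^+ 2).
Proof.
have m1 n' : \sum_(k < n'.+1) binw p n' k * k%:R = n'%:R * (1 - p).
  case: n' => [|n']; first by rewrite big_ord1 mulr0 !mul0r.
  transitivity (\sum_(k < n'.+2) binw p n'.+1 k * (k%:R * (fun=> 1) k.-1)).
    by apply: eq_bigr => k _; rewrite mulr1.
  rewrite (binw_shift p n' (fun=> 1)); under eq_bigr do rewrite mulr1.
  by rewrite binw_sum mulr1.
have m2 : \sum_(k < n.+1) binw p n k * k%:R ^+ 2 =
    n%:R * (1 - p) * p + (n%:R * (1 - p)) ^+ 2.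
  case: n => [|n]; first by rewrite big_ord1 expr0n/= mulr0 !mul0r expr0n addr0.
  transitivity (\sum_(k < n.+2) binw p n.+1 k * (k%:R * (fun j => j%:R + 1) k.-1)).
    apply: eq_bigr => -[[|k] hk] _ /=; first by rewrite expr0n/= !mul0r.
    by rewrite expr2 -natr1.
  rewrite (binw_shift p n (fun j => j%:R + 1)); under eq_bigr do rewrite mulrDr mulr1.
  by rewrite big_split/= m1 binw_sum -natr1; ring.
under eq_bigr do rewrite !mulrDr mulrC [X in _ + X + _]mulrCA [X in _ + X]mulrCA.
by rewrite !big_split/= -!mulr_sumr m1 m2 binw_sum mulr1.
Qed.

(** By [binw_shift], [n.+1 * (1 - p)] times the left side is the mass that [binw p n.+1] puts on
    [k >= 1]. *)
Lemma binw_inv_moment p n : 0 < p < 1 ->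
  \sum_(k < n.+1) binw p n k / k.+1%:R <= (n.+1%:R * (1 - p))^-1.
Proof.
move=> pp; have /andP[p0 p1] := pp.
have t0 : 0 < 1 - p by lra.
have n0 : 0 < n.+1%:R :> R by [].
rewrite -[leRHS]mul1r ler_pdivlMr ?mulr_gt0// mulrC.
rewrite -(binw_shift p n (fun k => k.+1%:R^-1)) -[leRHS](binw_sum p n.+1).
apply: ler_sum => -[[|k] hk] _; rewrite ler_piMr ?binw_ge0//=.
by rewrite divff ?pnatr_eq0.
Qed.

Lemma negb_sum p k : 0 < p < 1 -> series (negb p k) @ \oo --> (1 : R).
Proof.
move=> /andP[p0 p1]; have t0 : 1 - p != 0 by rewrite subr_eq0 gt_eqF.
have -> : series (negb p k) =
    (fun N => (1 - p) ^+ k.+1 * series (fun m => 'C(m, k)%:R * p ^+ (m - k)) N).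
  apply/funext => N; rewrite /series/= mulr_sumr; apply: eq_bigr => m _.
  by rewrite /negb; ring.
rewrite -[X in _ --> X](divff (expf_neq0 k.+1 t0)); apply: cvgMl_tmp.
by apply: negative_binomial_series; rewrite p1 ltW.
Qed.

(** Size biasing for the negative binomial law. It makes [m.+1] and [m.+1 * m.+2] the convenient
    basis for moments: each turns into a shifted total mass. *)
Lemma negb_shift p k m : 0 < p < 1 ->
  negb p k m * m.+1%:R = k.+1%:R / (1 - p) * negb p k.+1 m.+1.
Proof.
move=> /andP[p0 p1]; have t0 : 1 - p != 0 by rewrite subr_eq0 gt_eqF.
rewrite /negb subSS [(1 - p) ^+ k.+2]exprS.
transitivity ((m.+1 * 'C(m, k))%:R * (1 - p) ^+ k.+1 * p ^+ (m - k)).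
  by rewrite natrM; ring.
rewrite (mul_bin_diag m.+1 k) natrM.
set x := (1 - p) ^+ k.+1; by field.
Qed.

Lemma negb_moment p k (a b c : R) : 0 < p < 1 ->
  series (fun m => negb p k m * (a + b * m.+1%:R + c * (m.+1%:R * m.+2%:R)))
   @ \oo --> a + b * (k.+1%:R / (1 - p)) + c * (k.+1%:R * k.+2%:R / (1 - p) ^+ 2).
Proof.
move=> pp; have /andP[p0 p1] := pp; have t0 : 1 - p != 0 by rewrite subr_eq0 gt_eqF.
have m1 k' : series (fun m => negb p k'.+1 m.+1) @ \oo --> (1 : R).
  have -> : series (fun m => negb p k'.+1 m.+1) = series (negb p k'.+1) \o succn.
    apply/funext => N; rewrite /series/= big_nat_recl//=.
    by rewrite {2}/negb bin0n !mul0r add0r.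
  by rewrite cvg_shiftS; exact: negb_sum.
have m2 k' : series (fun m => negb p k'.+2 m.+2) @ \oo --> (1 : R).
  have -> : series (fun m => negb p k'.+2 m.+2) =
      series (fun m => negb p k'.+2 m.+1) \o succn.
    apply/funext => N; rewrite /series/= big_nat_recl//=.
    by rewrite {2}/negb bin_small// !mul0r add0r.
  by rewrite cvg_shiftS.
have -> : series (fun m => negb p k m * (a + b * m.+1%:R + c * (m.+1%:R * m.+2%:R))) =
   (fun N => a * series (negb p k) N +
      (b * (k.+1%:R / (1 - p))) * series (fun m => negb p k.+1 m.+1) N +
      (c * (k.+1%:R * k.+2%:R / (1 - p) ^+ 2)) * series (fun m => negb p k.+2 m.+2) N).
  apply/funext => N; rewrite /series/= !mulr_sumr -!big_split/=.
  apply: eq_bigr => m _.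
  rewrite (mulrDr (negb p k m) (a + _)) (mulrDr (negb p k m) a); congr (_ + _ + _).
  - by rewrite mulrC.
  - by rewrite mulrCA negb_shift// mulrA.
  - rewrite mulrCA (mulrA (negb _ _ _)) negb_shift// -(mulrA _ _ m.+2%:R) negb_shift//.
    by rewrite expr2 invfM !mulrA [_ / (1 - p) * k.+2%:R]mulrAC.
rewrite -[X in _ --> X + _ + _]mulr1 -[X in _ --> _ + X + _]mulr1 -[X in _ --> _ + _ + X]mulr1.
by apply: cvgD; [apply: cvgD|]; apply: cvgMl_tmp => //; exact: negb_sum.
Qed.

Lemma kern_weight p n : 0 < p < 1 -> weight (kern p n).
Proof.
move=> pp; split=> [m|]; first exact: kern_ge0.
have -> : series (kern p n) =
    (fun N => \sum_(k < n.+1) binw p n k * series (negb p k) N).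
  apply/funext => N; rewrite /series/= exchange_big/=; apply: eq_bigr => k _.
  by rewrite mulr_sumr.
rewrite -[X in _ --> X](binw_sum p n); apply: cvgn_sum => k.
by rewrite -[X in _ --> X]mulr1; apply: cvgMl_tmp; exact: negb_sum.
Qed.

(** Two generating functions are composed: birth sends [z ^+ m] to a multiple of [w ^+ k] with
    [w = (1 - p) * z / (1 - p * z)], and thinning sends [w ^+ k] to [(p + (1 - p) * w) ^+ n]. *)
Lemma kern_gen p n z : 0 < p < 1 -> 0 <= z <= 1 ->
  mean (kern p n) (fun m => z ^+ m) =
  (1 - p) / (1 - p * z) * (p + (1 - p) * ((1 - p) * z / (1 - p * z))) ^+ n.
Proof.
move=> pp zz; have /andP[p0 p1] := pp; have /andP[z0 z1] := zz.
have pz1 : p * z < 1 by rewrite (le_lt_trans _ p1)// ler_piMr// ltW.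
rewrite -binw_gen mulr_sumr; apply: mean_eq.
have -> : series (fun m => kern p n m * z ^+ m) =
    (fun N => \sum_(k < n.+1) (binw p n k * (1 - p) ^+ k.+1 * z ^+ k) *
       series (fun m => 'C(m, k)%:R * (p * z) ^+ (m - k)) N).
  apply/funext => N; rewrite /series/=.
  under eq_bigr do rewrite /kern mulr_suml.
  rewrite exchange_big/=; apply: eq_bigr => k _.
  rewrite mulr_sumr; apply: eq_bigr => m _; rewrite /negb.
  have [km|mk] := leqP k m; last by rewrite bin_small// !(mul0r, mulr0).
  have -> : z ^+ m = z ^+ k * z ^+ (m - k) by rewrite -exprD subnKC.
  by rewrite exprMn; ring.
apply: cvgn_sum => k.
have -> : (1 - p) / (1 - p * z) * (binw p n k * ((1 - p) * z / (1 - p * z)) ^+ k) =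
    (binw p n k * (1 - p) ^+ k.+1 * z ^+ k) * ((1 - p * z) ^+ k.+1)^-1.
  by rewrite !exprMn !exprS invfM exprVn; ring.
by apply: cvgMl_tmp; apply: negative_binomial_series; rewrite pz1 mulr_ge0// ltW.
Qed.

End Kernel.

(** * Functionals determined by their values on geometric sequences *)

Section Uniqueness.
Context {R : realType}.
Implicit Types (f g : nat -> R) (C : R).

(** Reduces operator identities to generating functions. Linearity and continuity under bounded
    pointwise convergence carry the vanishing from powers to the unit sequences [delta k], then to
    truncations, then to every bounded sequence. *)
Lemma eq0_of_vanishing_on_powers (Phi : (nat -> R) -> R) :
  (forall f g a C D, bounded_by C f -> bounded_by D g ->
     Phi (f \+ (a \*o g)) = Phi f + a * Phi g) ->
  (forall (f_ : nat -> nat -> R) C, (forall r, bounded_by C (f_ r)) ->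
     (forall m, f_ ^~ m @ \oo --> (0 : R)) ->
     (fun r => Phi (f_ r)) @ \oo --> (0 : R)) ->
  (forall z, 0 < z < 1 -> Phi (fun m => z ^+ m) = 0) ->
  forall f C, bounded_by C f -> Phi f = 0.
Proof.
move=> Plin Pcont Pz.
pose delta k : nat -> R := fun m => (m == k)%:R.
pose trunc N f : nat -> R := fun m => if (m < N)%N then f m else 0.
have b0 : bounded_by 0 (fun=> 0 : R) by move=> n; rewrite normr0.
have P0 : Phi (fun=> 0) = 0.
  have := Plin _ _ 1 _ _ b0 b0.
  have -> : (fun=> 0 : R) \+ (1 \*o (fun=> 0 : R)) = (fun=> 0) :> (nat -> R).
    by apply/funext => n /=; rewrite mulr0 addr0.
  lra.
have bdelta k : bounded_by 1 (delta k).
  by move=> n; rewrite /delta; case: eqP; rewrite ?normr1 ?normr0.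
have btrunc N f C : bounded_by C f -> bounded_by C (trunc N f).
  move=> fC n; rewrite /trunc; case: ifP => // _.
  by rewrite normr0 (bounded_by_ge0 fC).
have Ptrunc N f C : bounded_by C f -> (forall j, (j < N)%N -> Phi (delta j) = 0) ->
    Phi (trunc N f) = 0.
  move=> fC; elim: N => [_|N IHN hN].
    by rewrite -[RHS]P0; congr Phi; apply/funext => m; rewrite /trunc ltn0.
  have -> : trunc N.+1 f = trunc N f \+ (f N \*o delta N).
    apply/funext => m; rewrite /trunc /delta /= ltnS leq_eqVlt.
    have [->|mN] := eqVneq m N; first by rewrite ltnn add0r mulr1.
    by rewrite mulr0 addr0.
  rewrite (Plin _ _ _ C 1)//; last exact: btrunc.
  rewrite IHN ?hN ?mulr0 ?addr0// => j jN; apply: hN; exact: ltnW.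
have Pdelta k : Phi (delta k) = 0.
  (* (z^m - sum_(j < k) z^j delta_j) / z^k tends to delta_k as z tends to 0 *)
  elim/ltn_ind: k => k IHk.
  pose z r : R := r.+2%:R^-1.
  have z01 r : 0 < z r < 1 by rewrite invr_gt0 ltr0n/= invf_lt1// ltr1n.
  pose h r : nat -> R := fun m => if (m < k)%N then 0 else z r ^+ (m - k).
  have bz r j : `|z r ^+ j| <= 1.
    have /andP[z0 z1] := z01 r.
    by rewrite normrX ger0_norm ?exprn_ile1 ?ltW.
  have bh r : bounded_by 1 (h r).
    by move=> m; rewrite /h; case: ifP => _ //; rewrite normr0.
  have Ph r : Phi (h r) = 0.
    have := Pz _ (z01 r).
    have -> : (fun m => z r ^+ m) = trunc k (fun m => z r ^+ m) \+ (z r ^+ k \*o h r).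
      apply/funext => m; rewrite /trunc /h /=; case: ltnP => km.
        by rewrite mulr0 addr0.
      by rewrite add0r -exprD subnKC.
    rewrite (Plin _ _ _ 1 1 (btrunc _ _ _ (bz r)) (bh r)).
    rewrite (Ptrunc _ _ _ (bz r) IHk) add0r.
    move/eqP; rewrite mulf_eq0 expf_eq0 => /orP[/andP[_]|/eqP//].
    by have /andP[/gt_eqF ->] := z01 r.
  have hb r : bounded_by 2 (h r \+ (-1 \*o delta k)).
    move=> m; apply: (le_trans (ler_normD _ _)).
    by rewrite /= mulN1r normrN -[leRHS]/(1 + 1) lerD ?bh ?bdelta.
  have h0 m : (fun r => (h r \+ (-1 \*o delta k)) m) @ \oo --> (0 : R).
    rewrite /h /delta /=; have [mk|mk|->] := ltngtP m k.
    - by rewrite mulr0 addr0; exact: cvg_cst.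
    - rewrite mulr0; under eq_fun do rewrite addr0.
      have z0 : z @ \oo --> (0 : R).
        have := @cvg_harmonic R; rewrite -(cvg_shiftS (@harmonic R)).
        by apply: cvg_trans.
      have := @continuous_cvg _ _ _ _ _ z (fun x => x ^+ (m - k)) 0 (@exprn_continuous R (m - k) 0) z0.
      rewrite expr0n subn_eq0 leqNgt mk /=; apply; exact: _.
    - rewrite subnn mulr1; under eq_fun do rewrite expr0 subrr.
      exact: cvg_cst.
  have := Pcont _ _ hb h0.
  under eq_fun do rewrite (Plin _ _ _ 1 1)// Ph add0r mulN1r.
  move=> /cvg_lim; rewrite lim_cst// => /(_ (@norm_hausdorff _ _)).
  by move/eqP; rewrite oppr_eq0 => /eqP.
move=> f C fC.
pose tail r : nat -> R := f \+ (-1 \*o trunc r f).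
have tb r : bounded_by C (tail r).
  move=> m; rewrite /tail /trunc /= mulN1r; case: ifP => _.
    by rewrite subrr normr0 (bounded_by_ge0 fC).
  by rewrite subr0.
have t0 m : tail ^~ m @ \oo --> (0 : R).
  apply/cvgr0Pnorm_le => e e0; exists m.+1 => // r /= mr.
  by rewrite /tail /trunc /= mr mulN1r subrr normr0 ltW.
have := Pcont _ _ tb t0; rewrite /tail.
under eq_fun do rewrite (Plin _ _ _ _ _ fC (btrunc _ _ _ fC))
  (Ptrunc _ _ _ fC (fun j _ => Pdelta j)) mulr0 addr0.
move=> /cvg_lim; rewrite lim_cst//; apply; exact: norm_hausdorff.
Qed.
End Uniqueness.

(** * The semigroup *)

Section Heat.
Context {R : realType}.
Implicit Types (f g : nat -> R) (C s t : R).

Definition heat t f : nat -> R := fun n => mean (kern (t / (1 + t)) n) f.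

Lemma heat_param t : 0 < t -> 0 < t / (1 + t) < 1.
Proof.
by move=> t0; rewrite divr_gt0 ?ltr_pdivrMr ?mul1r ?ltrDr ?addr_gt0//= ltrDr.
Qed.

Lemma heat_weight t n : 0 < t -> weight (kern (t / (1 + t)) n).
Proof. by move=> t0; apply: kern_weight; exact: heat_param. Qed.

Lemma heat_bounded t f C : 0 < t -> bounded_by C f -> bounded_by C (heat t f).
Proof. by move=> t0 fC n; apply: mean_norm => //; exact: heat_weight. Qed.

Lemma heatD t f g C D : 0 < t -> bounded_by C f -> bounded_by D g ->
  heat t (f \+ g) = heat t f \+ heat t g.
Proof.
move=> t0 fC gD; apply/funext => n; rewrite /heat /=.
by rewrite (meanD _ fC gD)//; exact: heat_weight.
Qed.

Lemma heatZ t f a C : 0 < t -> bounded_by C f ->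
  heat t (a \*o f) = a \*o heat t f.
Proof.
move=> t0 fC; apply/funext => n; rewrite /heat /=.
by rewrite (meanZ _ _ fC)//; exact: heat_weight.
Qed.

Lemma heat_pow t z : 0 < t -> 0 <= z <= 1 ->
  heat t (fun m => z ^+ m) =
  (1 + t * (1 - z))^-1 \*o (fun n => (1 - (1 - z) / (1 + t * (1 - z))) ^+ n).
Proof.
move=> t0 zz; apply/funext => n; rewrite /heat kern_gen//; last exact: heat_param.
have /andP[z0 z1] := zz.
have h1 : 1 + t != 0 by rewrite gt_eqF// addr_gt0.
have h2 : 1 + t * (1 - z) != 0.
  by rewrite gt_eqF// ltr_pwDl// mulr_ge0 ?subr_ge0// ltW.
have h3 : 1 + t - t * z != 0 by rewrite -[X in X != _]/(1 + t - t * z); move: h2; rewrite mulrBr mulr1 addrA.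
rewrite /=; congr (_ * _ ^+ n); field; by rewrite h1 h2 ?h3.
Qed.

Lemma bounded_byD f g C D : bounded_by C f -> bounded_by D g ->
  bounded_by (C + D) (f \+ g).
Proof. by move=> fC gD n; rewrite /= (le_trans (ler_normD _ _))// lerD. Qed.

Lemma bounded_byB f g C D : bounded_by C f -> bounded_by D g ->
  bounded_by (C + D) (f \- g).
Proof. by move=> fC gD n; rewrite /= (le_trans (ler_normB _ _))// lerD. Qed.

Lemma bounded_byZ f a C : bounded_by C f -> bounded_by (`|a| * C) (a \*o f).
Proof. by move=> fC n; rewrite /= normrM ler_wpM2l. Qed.

(** It suffices to check powers. With [u = 1 - z], time [t] turns [u] into [u / (1 + t * u)], a flow
    additive in [t], and the prefactors [1 / (1 + t * u)] multiply accordingly. *)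
Lemma heat_semigroup s t f C : 0 < s -> 0 < t -> bounded_by C f ->
  heat s (heat t f) = heat (s + t) f.
Proof.
move=> s0 t0 fC; apply/funext => n; apply/eqP; rewrite -subr_eq0; apply/eqP.
have st0 : 0 < s + t by rewrite addr_gt0.
move: f C fC.
apply: (@eq0_of_vanishing_on_powers R (fun f => heat s (heat t f) n - heat (s + t) f n)).
- move=> f g a C D fC gD.
  have aD := bounded_byZ a gD.
  rewrite (heatD t0 fC aD) (heatD st0 fC aD) !(heatZ a _ gD)//.
  have htf := heat_bounded t0 fC.
  have htg := heat_bounded t0 gD.
  rewrite (heatD s0 htf (bounded_byZ a htg)) (heatZ a s0 htg) /=; ring.
- move=> f_ C fC f0; rewrite -(subrr 0); apply: cvgB; last first.
    by apply: (mean_tannery _ fC f0); exact: heat_weight.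
  (* Tannery is used twice: at time [t] it gives the pointwise convergence of [heat t (f_ r)] that
     the outer average at time [s] requires. *)
  apply: (@mean_tannery _ _ (fun r => heat t (f_ r)) C) => [|r|m].
  + exact: heat_weight.
  + exact: heat_bounded.
  + by apply: (mean_tannery _ fC f0); exact: heat_weight.
- move=> z /andP[/ltW z0 /ltW z1].
  have zz : 0 <= z <= 1 by rewrite z0.
  have u0 : 0 <= 1 - z by rewrite subr_ge0.
  have h2 r : 0 < r -> 0 < 1 + r * (1 - z).
    by move=> r0; rewrite ltr_pwDl// mulr_ge0// ltW.
  pose y := 1 - (1 - z) / (1 + t * (1 - z)).
  have yy : 0 <= y <= 1.
    have w0 : 0 <= (1 - z) / (1 + t * (1 - z)) by rewrite divr_ge0// ltW// h2.
    rewrite /y gerBl w0 andbT subr_ge0 ler_pdivrMr ?h2// mul1r.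
    have := mulr_ge0 (ltW t0) u0; lra.
  rewrite !heat_pow// -/y (@heatZ _ _ _ 1)//; last first.
    by move=> m; have /andP[y0 y1] := yy; rewrite normrX ger0_norm ?exprn_ile1.
  rewrite heat_pow//=.
  have e1 : 1 + s * (1 - y) = (1 + (s + t) * (1 - z)) / (1 + t * (1 - z)).
    by rewrite /y; field; rewrite gt_eqF ?h2.
  have e2 : (1 - y) / (1 + s * (1 - y)) = (1 - z) / (1 + (s + t) * (1 - z)).
    by rewrite e1 /y; field; rewrite !gt_eqF ?h2.
  rewrite e2 e1; apply/eqP; rewrite subr_eq0; apply/eqP; rewrite mulrA; congr (_ * _).
  by field; rewrite !gt_eqF ?h2.
Qed.

End Heat.

(** * Analyticity *)

Section Increment.
Context {R : realType}.
Implicit Types (f : nat -> R) (p x C : R) (k n m : nat).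

Lemma is_derive_sum_fun (N : nat) (h : nat -> R -> R) (dh : nat -> R) x :
  (forall i, is_derive x 1 (h i) (dh i)) ->
  is_derive x 1 (fun y => \sum_(0 <= i < N) h i y) (\sum_(0 <= i < N) dh i).
Proof.
move=> hd; rewrite big_mkord.
have -> : (fun y => \sum_(0 <= i < N) h i y) = \sum_(i < N) h i.
  by apply/funext => y; rewrite fct_sumE big_mkord.
exact: is_derive_sum.
Qed.

(** The derivative is kept as logarithmic derivative times function, so that the weights [binw] and
    [negb] can be factored out again. *)
Lemma is_derive_beta (a b : nat) x : 0 < x < 1 ->
  is_derive x 1 (fun y : R => (1 - y) ^+ a * y ^+ b)
   ((b%:R * (1 - x) - a%:R * x) / (x * (1 - x)) * ((1 - x) ^+ a * x ^+ b)).
Proof.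
move=> /andP[x0 x1].
have da : is_derive x 1 (fun y : R => (1 - y) ^+ a) (- (a%:R * (1 - x) ^+ a.-1)).
  have d1 : is_derive x (1 : R) (fun y : R => 1 - y) (-1).
    have := is_deriveB (is_derive_cst (1 : R) x (1 : R)) (is_derive_id x (1 : R)).
    by rewrite sub0r.
  have := is_deriveX a d1.
  by rewrite exprfctE /GRing.scale/= mulrN1.
have db : is_derive x 1 (fun y : R => y ^+ b) (b%:R * x ^+ b.-1).
  have := is_deriveX b (is_derive_id x (1 : R)).
  by rewrite exprfctE /GRing.scale/= mulr1.
apply: (is_derive_eq (is_deriveM da db)).
rewrite /GRing.scale/=.
have x0' : x != 0 by rewrite gt_eqF.
have t0 : 1 - x != 0 by rewrite subr_eq0 gt_eqF.
(* At exponent [0] the truncated predecessor is harmless because of the factor [a%:R]. *)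
have ea : a%:R * (1 - x) ^+ a.-1 = a%:R * (1 - x) ^+ a / (1 - x).
  by case: a {da} => [|a]; rewrite ?mul0r// exprSr mulrA mulfK.
have eb : b%:R * x ^+ b.-1 = b%:R * x ^+ b / x.
  by case: b {db} => [|b]; rewrite ?mul0r// exprSr mulrA mulfK.
rewrite eb ea; field; by rewrite x0' t0.
Qed.

(** The relative increment of [negb p k m] in [k] (see [negb_succ]), and [(1 - p) / k.+1] times the
    logarithmic derivative of [negb p k m] in [p]. It is centred, as [m.+1] has mean
    [k.+1 / (1 - p)] under [negb p k]. *)
Definition score p k m : R := (m.+1%:R * (1 - p) - k.+1%:R) / (k.+1%:R * p).

Lemma negb_succ p k m : 0 < p < 1 ->
  negb p k.+1 m = negb p k m * (1 + score p k m).
Proof.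
move=> /andP[p0 p1].
have k0 : k.+1%:R != 0 :> R by rewrite pnatr_eq0.
have x0 : p != 0 by rewrite gt_eqF.
have -> : 1 + score p k m = (m%:R - k%:R) * (1 - p) / (k.+1%:R * p).
  rewrite /score -!natr1; field.
  by rewrite natr1 k0 x0.
apply: (mulIf (mulf_neq0 k0 x0)); rewrite -[RHS]mulrA divfK ?mulf_neq0//.
rewrite /negb; have [km|mk] := leqP m k.
  rewrite bin_small ?ltnS// !mul0r.
  move: km; rewrite leq_eqVlt => /predU1P[->|mk]; first by rewrite subrr mul0r mulr0.
  by rewrite bin_small// !mul0r.
rewrite -(natrB _ (ltnW mk)).
transitivity ((k.+1 * 'C(m, k.+1))%:R * (1 - p) ^+ k.+2 * (p * p ^+ (m - k.+1))).
  by rewrite natrM; ring.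
rewrite mul_bin_left natrM -exprS subnSK// [(1 - p) ^+ k.+2]exprSr; ring.
Qed.

Lemma binw_succ p n k : (k <= n)%N ->
  binw p n k * ((1 - p) * (n%:R - k%:R)) = p * (k.+1%:R * binw p n k.+1).
Proof.
move=> kn; rewrite /binw -(natrB _ kn).
transitivity (((n - k) * 'C(n, k))%:R * (1 - p) ^+ k.+1 * p ^+ (n - k)).
  by rewrite natrM exprS; ring.
rewrite -mul_bin_left; move: kn; rewrite leq_eqVlt => /predU1P[->|kn].
  by rewrite bin_small// muln0 !mul0r !mulr0.
by rewrite natrM -subnSK// [p ^+ _.+1]exprS; ring.
Qed.

(* The derivative of the kernel in p, after a summation by parts: a factor in k
   times a score in m, both with explicit second moments. *)
Definition dkern p n m : R :=
  (\sum_(k < n.+1) binw p n k * ((k%:R - n%:R * (1 - p) + p) *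
     (negb p k m * score p k m))) / (p * (1 - p)).

Lemma is_derive_kern p n m : 0 < p < 1 ->
  is_derive p 1 (fun x => kern x n m) (dkern p n m).
Proof.
move=> pp; have /andP[p0 p1] := pp.
have x0 : p != 0 by rewrite gt_eqF.
have t0 : 1 - p != 0 by rewrite subr_eq0 gt_eqF.
(* The product of the two weights is a single monomial in [1 - x] and [x]; [D k] is its derivative
   at [p]. *)
pose h k x := ('C(n, k)%:R * 'C(m, k)%:R) *
  ((1 - x) ^+ (k + k.+1) * x ^+ ((n - k) + (m - k)) : R).
pose D k := ('C(n, k)%:R * 'C(m, k)%:R) *
  ((((n - k) + (m - k))%:R * (1 - p) - (k + k.+1)%:R * p) / (p * (1 - p)) *
  ((1 - p) ^+ (k + k.+1) * p ^+ ((n - k) + (m - k)) : R)).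
have -> : (fun x => kern x n m) = (fun x => \sum_(0 <= k < n.+1) h k x).
  apply/funext => x; rewrite big_mkord; apply: eq_bigr => k _.
  by rewrite /binw /negb /h !exprD; ring.
have -> : dkern p n m = \sum_(0 <= k < n.+1) D k.
  (* [G] vanishes at [0] and at [n.+1], so its increments may be subtracted for free. They are
     chosen to cancel the part of [D k] that has no factor [score]. *)
  pose G k := p * (k%:R * binw p n k * negb p k m).
  have tel : \sum_(0 <= k < n.+1) (G k.+1 - G k) = 0.
    by rewrite telescope_sumr// /G /binw bin_small// !(mul0r, mulr0) subrr.
  transitivity (\sum_(0 <= k < n.+1) D k -
      (\sum_(0 <= k < n.+1) (G k.+1 - G k)) / (p * (1 - p))).
    rewrite /dkern !mulr_suml -sumrB big_mkord; apply: eq_bigr => k _.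
    have kn : (k <= n)%N by rewrite -ltnS.
  have -> : D k = binw p n k * negb p k m *
     ((n%:R * (1 - p) - k%:R) + k.+1%:R * p * score p k m) / (p * (1 - p)).
    have -> : k.+1%:R * p * score p k m = m.+1%:R * (1 - p) - k.+1%:R.
      by rewrite /score mulrC divfK// mulf_neq0// pnatr_eq0.
    rewrite /D /binw /negb; have [km|mk] := leqP k m; last first.
      by rewrite (bin_small mk) !(mul0r, mulr0).
    by rewrite !natrD (natrB _ kn) (natrB _ km) -!natr1 !exprD !exprS; ring.
  have -> : G k.+1 = binw p n k * ((1 - p) * (n%:R - k%:R)) *
      (negb p k m * (1 + score p k m)).
    by rewrite /G -negb_succ// binw_succ// !mulrA.
  by rewrite /G -natr1; set d := (_ * _)^-1; ring.
  by rewrite tel mul0r subr0.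
apply: is_derive_sum_fun => k; apply: is_derive_eq.
  exact: (is_deriveZ ('C(n, k)%:R * 'C(m, k)%:R) (is_derive_beta (k + k.+1) (n - k + (m - k)) pp)).
by [].
Qed.

(** The second moment of the score under [negb p k] is exactly [1 / (k.+1 * p)]; partial sums of
    nonnegative terms stay below the total. *)
Lemma sum_negb_score_le p k N (a b : R) : 0 < p < 1 -> 0 <= a -> 0 <= b ->
  \sum_(0 <= m < N) negb p k m * (a + b * score p k m ^+ 2) <=
  a + b / (k.+1%:R * p).
Proof.
move=> pp a0 b0; have /andP[p0 p1] := pp.
have x0 : p != 0 by rewrite gt_eqF.
have t0 : 1 - p != 0 by rewrite subr_eq0 gt_eqF.
have k0 : k.+1%:R != 0 :> R by rewrite pnatr_eq0.
(* The coefficients below are those of [a + b * score ^+ 2] in the basis [1], [m.+1], [m.+1 * m.+2]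
   of [negb_moment]. *)
pose e := b / (k.+1%:R * p) ^+ 2.
have := @negb_moment R p k (a + e * k.+1%:R ^+ 2)
   (- e * ((1 - p) ^+ 2 + 2 * (1 - p) * k.+1%:R)) (e * (1 - p) ^+ 2) pp.
have -> : (fun m => negb p k m * (a + e * k.+1%:R ^+ 2 +
    - e * ((1 - p) ^+ 2 + 2 * (1 - p) * k.+1%:R) * m.+1%:R +
    e * (1 - p) ^+ 2 * (m.+1%:R * m.+2%:R))) =
   (fun m => negb p k m * (a + b * score p k m ^+ 2)).
  apply/funext => m; congr (_ * _).
  have -> : m.+2%:R = m.+1%:R + 1 :> R by rewrite natr1.
  by rewrite /score /e; move: k0; move: (k.+1%:R) (m.+1%:R) => K M k0; field; rewrite k0 x0.
have -> : (a + e * k.+1%:R ^+ 2 + - e * ((1 - p) ^+ 2 + 2 * (1 - p) * k.+1%:R) *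
   (k.+1%:R / (1 - p)) + e * (1 - p) ^+ 2 * (k.+1%:R * k.+2%:R / (1 - p) ^+ 2)) =
   a + b / (k.+1%:R * p).
  have -> : k.+2%:R = k.+1%:R + 1 :> R by rewrite natr1.
  by rewrite /e; move: k0; move: (k.+1%:R) => K k0; field; rewrite k0 x0 t0.
apply: nonneg_series_le => m; rewrite mulr_ge0 ?negb_ge0//.
by rewrite addr_ge0// mulr_ge0// sqr_ge0.
Qed.

(** A bound on the [l1] norm of the derivative, uniform in [n]. The factor [y] has mean square at
    most [lam] and the score has mean square at most [1 / lam], so their product has mean at most
    [1]. *)
Lemma sum_dkern_le p n N : 0 < p < 1 -> p <= 2^-1 ->
  \sum_(0 <= m < N) `|dkern p n m| <= (p * (1 - p))^-1.
Proof.
move=> pp p2; have /andP[p0 p1] := pp.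
have t0 : 0 < 1 - p by rewrite subr_gt0.
have n0 : 0 < n.+1%:R :> R by rewrite ltr0n.
have d0 : 0 < p * (1 - p) by rewrite mulr_gt0.
pose y k : R := k%:R - n%:R * (1 - p) + p.
(* The scale that balances the two halves of the arithmetic-geometric mean inequality: each will
   contribute at most [1 / 2]. *)
pose lam := n.+1%:R * (1 - p) * p.
have lam0 : 0 < lam by rewrite !mulr_gt0.
apply: (@le_trans _ _ ((\sum_(k < n.+1) binw p n k * \sum_(0 <= m < N)
    negb p k m * (y k ^+ 2 / (2 * lam) + (lam / 2) * score p k m ^+ 2)) / (p * (1 - p)))).
  under [X in _ <= X / _]eq_bigr do rewrite mulr_sumr.
  rewrite exchange_big mulr_suml/=; apply: ler_sum => m _.
  rewrite /dkern normrM [`|_^-1|]ger0_norm ?invr_ge0 ?(ltW d0)// ler_wpM2r ?invr_ge0 ?(ltW d0)//.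
  apply: (le_trans (ler_norm_sum _ _ _)); apply: ler_sum => k _.
  rewrite normrM ger0_norm ?binw_ge0// ler_wpM2l ?binw_ge0//.
  rewrite mulrCA normrM ger0_norm ?negb_ge0// ler_wpM2l ?negb_ge0// -/(y k) normrM.
  (* AM-GM: 2 |y| |s| <= y^2 / lam + lam s^2 *)
  rewrite -[y k ^+ 2]real_normK ?num_real// -[score _ _ _ ^+ 2]real_normK ?num_real//.
  set u := `|y k|; set v := `|score _ _ _|.
  rewrite -subr_ge0.
  have -> : u ^+ 2 / (2 * lam) + lam / 2 * v ^+ 2 - u * v =
      (u - lam * v) ^+ 2 / (2 * lam) by field; rewrite gt_eqF.
  by rewrite divr_ge0 ?sqr_ge0// mulr_ge0// ltW.
rewrite -[leRHS]mul1r ler_wpM2r ?invr_ge0 ?(ltW d0)//.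
apply: (@le_trans _ _ (\sum_(k < n.+1) binw p n k *
    (y k ^+ 2 / (2 * lam) + lam / 2 / (k.+1%:R * p)))).
  apply: ler_sum => k _; rewrite ler_wpM2l ?binw_ge0//.
  apply: sum_negb_score_le => //; last by rewrite divr_ge0// ltW.
  by rewrite divr_ge0 ?sqr_ge0// mulr_ge0// ltW.
under eq_bigr do rewrite mulrDr; rewrite big_split/=.
have -> : \sum_(k < n.+1) binw p n k * (y k ^+ 2 / (2 * lam)) =
    (n%:R * (1 - p) * p + p ^+ 2) / (2 * lam).
  under eq_bigr do rewrite mulrA.
  rewrite -mulr_suml; congr (_ / _).
  transitivity (\sum_(k < n.+1) binw p n k * ((n%:R * (1 - p) - p) ^+ 2 +
     (- 2 * (n%:R * (1 - p) - p)) * k%:R + 1 * k%:R ^+ 2)).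
    by apply: eq_bigr => k _; rewrite /y; ring.
  by rewrite binw_moment; ring.
have -> : \sum_(k < n.+1) binw p n k * (lam / 2 / (k.+1%:R * p)) =
    lam / (2 * p) * \sum_(k < n.+1) binw p n k / k.+1%:R.
  rewrite mulr_sumr; apply: eq_bigr => k _.
  have : k.+1%:R != 0 :> R by rewrite pnatr_eq0.
  move: (k.+1%:R) => K K0; field.
  by rewrite K0 gt_eqF.
(* Here [p <= 1 / 2] enters, through [p ^+ 2 <= (1 - p) * p]. *)
have h1 : (n%:R * (1 - p) * p + p ^+ 2) / (2 * lam) <= 2^-1.
  rewrite ler_pdivrMr ?mulr_gt0// mulKf ?pnatr_eq0// /lam -natr1.
  have : p ^+ 2 <= (1 - p) * p by rewrite expr2 ler_wpM2r ?(ltW p0)//; lra.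
  lra.
have h2 : lam / (2 * p) * \sum_(k < n.+1) binw p n k / k.+1%:R <= 2^-1.
  apply: (@le_trans _ _ (lam / (2 * p) * (n.+1%:R * (1 - p))^-1)).
    by rewrite ler_wpM2l ?binw_inv_moment// divr_ge0 ?mulr_ge0// ltW.
  by rewrite le_eqVlt /lam; apply/orP; left; apply/eqP; field; rewrite !gt_eqF.
by have := lerD h1 h2; lra.
Qed.

(** The mean value theorem is applied to the partial sums, which are finite, and the bound passes to
    the limit. The intermediate point [c] satisfies [p * (1 - q) <= c * (1 - c)]. *)
Lemma kern_increment p q n f C : 0 < p -> p < q -> q <= 2^-1 -> bounded_by C f ->
  `|mean (kern q n) f - mean (kern p n) f| <= C * ((q - p) / (p * (1 - q))).
Proof.
move=> p0 pq q2 fC; have C0 := bounded_by_ge0 fC.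
have pp : 0 < p < 1 by rewrite p0; lra.
have qq : 0 < q < 1 by rewrite (lt_trans p0 pq); lra.
apply: (cvgn_norm_le (cvgB (mean_cvg (kern_weight n qq) fC)
  (mean_cvg (kern_weight n pp) fC))) => N.
pose F (x : R) := \sum_(0 <= m < N) kern x n m * f m.
pose dF (x : R) := \sum_(0 <= m < N) dkern x n m * f m.
have dFx (x : R) : 0 < x < 1 -> is_derive x 1 F (dF x).
  move=> xx; apply: is_derive_sum_fun => m.
  have := is_deriveZ (f m) (is_derive_kern n m xx).
  have -> : f m \*: (fun x => kern x n m) = (fun x => kern x n m * f m).
    by apply/funext => z; rewrite /= mulrC.
  by rewrite /GRing.scale/= mulrC.
have [||c /[!in_itv]/= /andP[pc cq] e] := @MVT R F dF p q pq.
- by move=> x /[!in_itv]/= /andP[px xq]; apply: dFx; lra.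
- apply: derivable_within_continuous => x /[!in_itv]/= /andP[px xq].
  have xx : 0 < x < 1 by lra.
  by have [] := dFx _ xx.
rewrite -[X in `|X|]/(F q - F p) e normrM (ger0_norm (_ : 0 <= q - p)) ?subr_ge0 ?(ltW pq)//.
have cc : 0 < c < 1 by lra.
apply: (@le_trans _ _ (C / (c * (1 - c)) * (q - p))).
  rewrite ler_wpM2r ?subr_ge0 ?(ltW pq)// (le_trans (ler_norm_sum _ _ _))//.
  apply: (@le_trans _ _ (C * \sum_(0 <= m < N) `|dkern c n m|)).
    rewrite mulr_sumr; apply: ler_sum => m _.
    by rewrite normrM mulrC ler_wpM2r.
  by rewrite ler_wpM2l// sum_dkern_le//; lra.
rewrite -mulrA ler_wpM2l// mulrC ler_wpM2l ?subr_ge0 ?(ltW pq)//.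
rewrite lef_pV2 ?posrE ?mulr_gt0 ?ler_pM//; lra.
Qed.

End Increment.

(** * Commuting additive operators on bounded sequences *)

Section BoundedOperators.
Context {R : realType}.
Implicit Types (f g r : nat -> R) (C : R) (A B : (nat -> R) -> (nat -> R)).

Definition is_bounded f := exists C, bounded_by C f.

Lemma is_boundedD f g : is_bounded f -> is_bounded g -> is_bounded (f \+ g).
Proof. by move=> [C fC] [D gD]; exists (C + D); exact: bounded_byD. Qed.

Lemma is_boundedB f g : is_bounded f -> is_bounded g -> is_bounded (f \- g).
Proof. by move=> [C fC] [D gD]; exists (C + D); exact: bounded_byB. Qed.

(** The conditions are restricted to bounded sequences, where [mean] is a genuine limit. *)
Definition additive_op A :=
  (forall f, is_bounded f -> is_bounded (A f)) /\
  (forall f g, is_bounded f -> is_bounded g -> A (f \+ g) = A f \+ A g).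

Definition commuting_ops A B := forall f, is_bounded f -> A (B f) = B (A f).

Lemma is_bounded0 : is_bounded (fun=> 0).
Proof. by exists 0 => n; rewrite normr0. Qed.

Lemma additive_op0 A : additive_op A -> A (fun=> 0) = (fun=> 0).
Proof.
move=> [_ AD]; have := AD _ _ is_bounded0 is_bounded0.
have -> : (fun=> 0 : R) \+ (fun=> 0) = (fun=> 0) :> (nat -> R) by apply/funext => n /=; rewrite addr0.
move=> e; apply/funext => n.
have {}e : A (fun=> 0) n = A (fun=> 0) n + A (fun=> 0) n by rewrite {1}e.
lra.
Qed.

Lemma additive_op_iter A k : additive_op A -> additive_op (iter k A).
Proof.
move=> [Ab AD]; elim: k => [|k [IHb IHD]]; first by split.
split=> [f fb|f g fb gb] /=; first by apply: Ab; exact: IHb.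
by rewrite IHD// AD//; exact: IHb.
Qed.

Lemma commuting_ops_iter A B k : additive_op B -> commuting_ops A B ->
  commuting_ops A (iter k B).
Proof.
move=> Bop AB; elim: k => //= k IHk f fb.
by rewrite AB ?IHk//; apply: (additive_op_iter k Bop).1.
Qed.

Lemma commuting_ops_sym A B : commuting_ops A B -> commuting_ops B A.
Proof. by move=> AB f fb; rewrite AB. Qed.

Definition co_op A f := f \- A f.

Lemma additive_op_co A : additive_op A -> additive_op (co_op A).
Proof.
move=> [Ab AD]; split=> [f fb|f g fb gb]; first by apply: is_boundedB => //; exact: Ab.
by rewrite /co_op AD//; apply/funext => n /=; ring.
Qed.

Lemma co_op_split A f : f = A f \+ co_op A f.
Proof. by apply/funext => n; rewrite /co_op /= addrC subrK. Qed.

(** Apply [A] to [f = A f + (1 - A) f] and use additivity. *)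
Lemma commuting_ops_co A : additive_op A -> commuting_ops A (co_op A).
Proof.
move=> Aop f fb; have [Ab AD] := Aop.
have := AD _ _ (Ab _ fb) ((additive_op_co Aop).1 _ fb).
rewrite -co_op_split => e; apply/funext => n.
have {}e : A f n = A (A f) n + A (co_op A f) n by rewrite {1}e.
by rewrite -[RHS]/(A f n - A (A f) n) e addrC addKr.
Qed.

(* Expanding (A + (1 - A))^(a + b): every term contains A^a or (1 - A)^b. *)
Lemma binomial_split A a b f C : additive_op A ->
  (forall g D, bounded_by D g -> bounded_by D (A g)) ->
  bounded_by C f ->
  exists g r, [/\ is_bounded g, bounded_by (2 ^+ (a + b) * C) r &
    f = iter a A g \+ iter b (co_op A) r].
Proof.
move=> Aop Ac; have Bop := additive_op_co Aop.
have AB := commuting_ops_co Aop.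
elim: a b f C => [b f C fC|a IHa b].
  exists f, (fun=> 0); split; first by exists C.
    by move=> n; rewrite normr0 mulr_ge0 ?(bounded_by_ge0 fC)// exprn_ge0.
  rewrite (additive_op0 (additive_op_iter b Bop)).
  by apply/funext => n /=; rewrite addr0.
elim: b => [f C fC|b IHb f C fC].
  exists (fun=> 0), f; split; first exact: is_bounded0.
    move=> n; apply: (le_trans (fC n)).
    by rewrite ler_peMl ?(bounded_by_ge0 fC)// exprn_ege1// ler1n.
  rewrite (additive_op0 (additive_op_iter a.+1 Aop)).
  by apply/funext => n /=; rewrite add0r.
(* In [f = A f + (1 - A) f], the first term uses the splitting for [(a, b.+1)] and the second the
   one for [(a.+1, b)]. The bounds on the remainders add up as [A] is a contraction. *)
have [g1 [r1 [g1b r1b e1]]] := IHa b.+1 f C fC.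
have [g2 [r2 [g2b r2b e2]]] := IHb f C fC.
have ir1 : is_bounded r1 by exists (2 ^+ (a + b.+1) * C).
have ir2 : is_bounded r2 by exists (2 ^+ (a.+1 + b) * C).
exists (g1 \+ co_op A g2), (A r1 \+ r2); split.
- by apply: is_boundedD => //; exact: Bop.1.
- have -> : 2 ^+ (a.+1 + b.+1) * C = 2 ^+ (a + b.+1) * C + 2 ^+ (a.+1 + b) * C.
    by rewrite !addSn !addnS !exprS; ring.
  exact: bounded_byD (Ac _ _ r1b) r2b.
rewrite {1}(co_op_split A f) {1}e1 {1}e2.
rewrite Aop.2; [|exact: (additive_op_iter a Aop).1|exact: (additive_op_iter b.+1 Bop).1].
rewrite Bop.2; [|exact: (additive_op_iter a.+1 Aop).1|exact: (additive_op_iter b Bop).1].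
rewrite (additive_op_iter a.+1 Aop).2//; last exact: Bop.1.
rewrite (additive_op_iter b.+1 Bop).2//; last exact: Aop.1.
rewrite (commuting_ops_iter b.+1 Bop AB ir1).
rewrite (commuting_ops_iter a.+1 Aop (commuting_ops_sym AB) g2b).
by apply/funext => n /=; ring.
Qed.

End BoundedOperators.

(** * Closures of the ranges of the semigroup *)

Section HeatRange.
Context {R : realType}.
Implicit Types (f g r : nat -> R) (C s t h eps : R).

(** The kernel estimate in the time variable: for [p = s / (1 + s)] and [q = t / (1 + t)] the ratio
    [(q - p) / (p * (1 - q))] is [(t - s) / s], and [t <= 1] means [q <= 1 / 2]. *)
Lemma heat_increment s t f C n : 0 < s -> s < t -> t <= 1 -> bounded_by C f ->
  `|heat t f n - heat s f n| <= C * ((t - s) / s).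
Proof.
move=> s0 st t1 fC; have t0 : 0 < t by rewrite (lt_trans s0).
have s1 : 0 < 1 + s by rewrite addr_gt0.
have t1' : 0 < 1 + t by rewrite addr_gt0.
have -> : (t - s) / s = (t / (1 + t) - s / (1 + s)) / (s / (1 + s) * (1 - t / (1 + t))).
  have -> : 1 - t / (1 + t) = (1 + t)^-1 by field; rewrite gt_eqF.
  by field; rewrite !gt_eqF.
apply: kern_increment => //.
- by rewrite divr_gt0.
- by rewrite ltr_pdivrMr// mulrAC ltr_pdivlMr//; lra.
- by rewrite ler_pdivrMr//; lra.
Qed.

Lemma additive_heat h : 0 < h -> additive_op (@heat R h).
Proof.
move=> h0; split=> [f [C fC]|f g [C fC] [D gD]]; last exact: heatD fC gD.
by exists C; exact: heat_bounded.
Qed.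

Lemma iter_heat h k f : 0 < h -> is_bounded f ->
  iter k.+1 (heat h) f = heat (k.+1%:R * h) f.
Proof.
move=> h0 [C fC]; elim: k => [|k IHk]; first by rewrite mul1r.
rewrite iterS IHk (heat_semigroup _ _ fC) ?mulr_gt0//; congr heat.
by rewrite -[in RHS]natr1; ring.
Qed.

(** Each factor [1 - X], with [X = heat h], is paired with sixteen factors [X]: [X^16 (1 - X)] is
    the difference of the semigroup at times [16 h] and [17 h], of norm at most [h / (16 h)]. *)
Lemma heat_iter_co_small h k f C : 0 < h -> 17 * h <= 1 -> bounded_by C f ->
  bounded_by (C / 16 ^+ k) (iter (16 * k) (heat h) (iter k (co_op (heat h)) f)).
Proof.
move=> h0 h1; have Aop := additive_heat h0.
have Bop := additive_op_co Aop.
elim: k f C => [|k IHk] f C fC; first by rewrite divr1.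
have fb : is_bounded f by exists C.
rewrite mulnS addnC iterD (iterSr k (co_op _)).
have -> : iter 16 (heat h) (iter k (co_op (heat h)) (co_op (heat h) f)) =
    iter k (co_op (heat h)) (iter 16 (heat h) (co_op (heat h) f)).
  apply: (commuting_ops_iter _ Bop); last exact: Bop.1.
  apply/commuting_ops_sym/(commuting_ops_iter _ Aop)/commuting_ops_sym.
  exact: commuting_ops_co.
pose u := iter 16 (heat h) (co_op (heat h) f).
suff uC : bounded_by (C / 16) u.
  by have := IHk _ _ uC; rewrite exprS invfM mulrA.
move=> n; rewrite /u /co_op.
have -> : iter 16 (heat h) (f \- heat h f) = iter 16 (heat h) f \- iter 17 (heat h) f.
  rewrite (iterSr 16 (heat h)).
  (* Additivity on [f = (f - X f) + X f] yields the value of [X^16] on the difference. *)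
  have e := (additive_op_iter 16 Aop).2 _ _ (is_boundedB fb (Aop.1 _ fb)) (Aop.1 _ fb).
  have e' : (f \- heat h f) \+ heat h f = f by apply/funext => m /=; rewrite subrK.
  by rewrite e' in e; rewrite [in RHS]e; apply/funext => m; exact/esym/addrK.
rewrite !iter_heat// distrC.
apply: (le_trans (heat_increment n _ _ _ fC)); rewrite ?mulr_gt0//.
  by rewrite ltr_pM2r// ltr_nat.
rewrite ler_wpM2l ?(bounded_by_ge0 fC)// -mulrBl -natrB//.
by rewrite -mulf_div divff ?gt_eqF// mulr1 mul1r.
Qed.

(** Write [f = X^k g + (1 - X)^k r] with [r] bounded by [4^k C], and apply [X^(16 k)], which is time
    [s]. The term in [g] sits at time [17 s / 16]; the other is at most [4^k C / 16^k]. *)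
Lemma heat_step s f eps : 0 < s -> is_bounded f -> 0 < eps ->
  exists2 g, is_bounded g &
    forall n, `|heat s f n - heat (s * (17 / 16)) g n| <= eps.
Proof.
move=> s0 [C fC] e0; have C0 := bounded_by_ge0 fC.
(* The first bound gives [C / eps <= 4 ^+ k], the second [2 * s < k], hence [17 * h <= 1]. *)
pose k := maxn (Num.bound (C / eps)) (Num.bound (2 * s)).
have k1 : C / eps <= 4 ^+ k.
  have h1 : C / eps < 2 ^+ k by apply: upper_nthrootP; rewrite leq_maxl.
  by rewrite (le_trans (ltW h1))// lerXn2r ?nnegrE// ler_nat.
have k2 : 2 * s < k%:R.
  have h1 := archi_boundP (mulr_ge0 (ler0n R 2) (ltW s0)).
  by rewrite (lt_le_trans h1)// ler_nat leq_maxr.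
have k0 : 0 < k%:R :> R by rewrite (lt_trans _ k2)// mulr_gt0.
have kN : (0 < k)%N by rewrite -(ltr0n R).
pose h := s / (16 * k%:R).
have h0 : 0 < h by rewrite divr_gt0// mulr_gt0.
have h1 : 17 * h <= 1.
  by rewrite /h mulrA ler_pdivrMr ?mulr_gt0//; lra.
have Aop := additive_heat h0; have Bop := additive_op_co Aop.
have [g [r [gb rC e]]] := binomial_split k k Aop (fun g D => @heat_bounded R h g D h0) fC.
exists g => // n.
have rb : is_bounded r by exists (2 ^+ (k + k) * C).
have it j f' : (0 < j)%N -> is_bounded f' -> iter j (heat h) f' = heat (j%:R * h) f'.
  by case: j => // j _; exact: iter_heat.
have es : heat s f = iter (16 * k) (heat h) f.
  rewrite it ?muln_gt0 ?kN//; last by exists C.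
  by congr heat; rewrite /h natrM; field; rewrite gt_eqF.
have eg : heat (s * (17 / 16)) g = iter (16 * k) (heat h) (iter k (heat h) g).
  rewrite -iterD it ?addn_gt0 ?kN ?orbT//; congr heat.
  by rewrite /h natrD natrM; field; rewrite gt_eqF.
have -> : heat s f n - heat (s * (17 / 16)) g n =
    iter (16 * k) (heat h) (iter k (co_op (heat h)) r) n.
  rewrite es eg {1}e (additive_op_iter (16 * k) Aop).2.
  - by rewrite /= addrC addKr.
  - exact: (additive_op_iter k Aop).1.
  - exact: (additive_op_iter k Bop).1.
apply: (le_trans (heat_iter_co_small k h0 h1 rC n)).
rewrite exprD -exprMn -natrM ler_pdivrMr ?exprn_gt0//.
have -> : 16 ^+ k = 4 ^+ k * 4 ^+ k :> R by rewrite -exprMn -natrM.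
rewrite mulrCA ler_pM2l ?exprn_gt0//.
by rewrite mulrC -ler_pdivrMr.
Qed.

Lemma bernoulli_le (x : R) j : 0 <= x -> 1 + j%:R * x <= (1 + x) ^+ j.
Proof.
move=> x0; elim: j => [|j IHj]; first by rewrite mul0r addr0 expr0.
rewrite exprS; apply: (@le_trans _ _ ((1 + x) * (1 + j%:R * x))).
  rewrite -natr1; have : 0 <= j%:R * x * x by rewrite !mulr_ge0.
  lra.
by rewrite ler_wpM2l// addr_ge0.
Qed.

(** [heat_step] is iterated, with half of the remaining tolerance spent each time, until the time
    exceeds [1]; the excess [s - 1] is then absorbed into the sequence. *)
Lemma heat_range_dense s f eps : 0 < s -> is_bounded f -> 0 < eps ->
  exists2 g, is_bounded g & forall n, `|heat s f n - heat 1 g n| <= eps.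
Proof.
move=> s0 fb e0.
have [j hj] : exists j, 1 < s * (17 / 16) ^+ j.
  (* By Bernoulli, [s * (1 + 1/16)^j >= s + s * j / 16], which exceeds [1] once [j > 16 / s]. *)
  exists (Num.bound (16 / s)).
  have h := archi_boundP (divr_ge0 (ler0n R 16) (ltW s0)).
  move: h; set j := Num.bound _; rewrite ltr_pdivrMr// => h.
  have := @bernoulli_le 16^-1 j; rewrite invr_ge0 ler0n => /(_ isT) b.
  rewrite (_ : 17 / 16 = 1 + 16^-1); last by field.
  apply: (@lt_le_trans _ _ (s * (1 + j%:R * 16^-1))); last by rewrite ler_pM2l.
  by lra.
elim: j s f eps s0 fb e0 hj => [|j IHj] s f eps s0 fb e0 hj.
  rewrite expr0 mulr1 in hj; have [C fC] := fb.
  exists (heat (s - 1) f); first by exists C; apply: heat_bounded => //; rewrite subr_gt0.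
  move=> n; rewrite (heat_semigroup _ _ fC) ?subr_gt0//.
  by rewrite [1 + _]addrC subrK subrr normr0 ltW.
have e2 : 0 < eps / 2 by rewrite divr_gt0.
have [g1 g1b h1] := heat_step s0 fb e2.
have [||g gb h2] := IHj (s * (17 / 16)) g1 (eps / 2) _ g1b e2.
- by rewrite mulr_gt0.
- by rewrite -mulrA -exprS.
exists g => // n; rewrite [leRHS]splitr; apply: le_trans (lerD (h1 n) (h2 n)).
by apply: le_trans (ler_normD _ _); rewrite addrA subrK.
Qed.

End HeatRange.

(** * Convergence to the identity at small times *)

Section SmallTime.
Context {R : realType}.
Implicit Types (f g : nat -> R) (C p t eps delta : R) (m n : nat).

(** The right side is the exact second moment, found by expanding [(m - n)^2] in [1], [m.+1],
    [m.+1 * m.+2]; for the semigroup, [p / (1 - p)] is the time. *)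
Lemma kern_second_moment p n N : 0 < p < 1 ->
  \sum_(0 <= m < N) kern p n m * (m%:R - n%:R) ^+ 2 <=
  (n%:R * 2 + 1) * (p / (1 - p)) + 2 * (p / (1 - p)) ^+ 2.
Proof.
move=> pp; have /andP[p0 p1] := pp.
have t0 : 1 - p != 0 by rewrite subr_eq0 gt_eqF.
pose a : R := (n%:R + 1) ^+ 2.
pose b : R := - (2 * n%:R + 3).
pose v k := a + b * (k.+1%:R / (1 - p)) + 1 * (k.+1%:R * k.+2%:R / (1 - p) ^+ 2).
have -> : (n%:R * 2 + 1) * (p / (1 - p)) + 2 * (p / (1 - p)) ^+ 2 =
    \sum_(k < n.+1) binw p n k * v k.
  pose d := (1 - p)^-1.
  transitivity (\sum_(k < n.+1) binw p n k * ((a + b * d + 2 * d ^+ 2) +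
     (b * d + 3 * d ^+ 2) * k%:R + d ^+ 2 * k%:R ^+ 2)).
    by rewrite binw_moment /a /b /d; move: (n%:R : R) => x; field.
  apply: eq_bigr => k _; congr (_ * _); rewrite /v /d.
  have -> : k.+2%:R = k%:R + 2 :> R by rewrite -addn2 natrD.
  have -> : k.+1%:R = k%:R + 1 :> R by rewrite natr1.
  by move: (k%:R : R) => x; field.
apply: (@nonneg_series_le R (fun m => kern p n m * (m%:R - n%:R) ^+ 2)).
  by move=> m; rewrite mulr_ge0 ?kern_ge0// sqr_ge0.
have -> : series (fun m => kern p n m * (m%:R - n%:R) ^+ 2) =
   (fun N' => \sum_(k < n.+1) binw p n k * series (fun m =>
      negb p k m * (a + b * m.+1%:R + 1 * (m.+1%:R * m.+2%:R))) N').
  apply/funext => N'; rewrite /series/=.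
  under eq_bigr do rewrite /kern mulr_suml.
  rewrite exchange_big/=; apply: eq_bigr => k _.
  rewrite mulr_sumr; apply: eq_bigr => m _; rewrite -mulrA; do 2 congr (_ * _).
  have -> : m.+2%:R = m%:R + 2 :> R by rewrite -addn2 natrD.
  have -> : m.+1%:R = m%:R + 1 :> R by rewrite natr1.
  by rewrite /a /b; ring.
apply: cvgn_sum => k; apply: cvgMl_tmp; exact: negb_moment.
Qed.

(** Factor [m - n] as [(x + y) * (x - y)] with the square roots [x], [y]. For [m != n] one has
    [x ^+ 2 + y ^+ 2 >= 1], which allows [n.+1] on the left and so covers [n = 0]. *)
Lemma sqrt_dist_le m n :
  n.+1%:R * (Num.sqrt m%:R - Num.sqrt n%:R) ^+ 2 <= 2 * (m%:R - n%:R) ^+ 2 :> R.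
Proof.
have [->|mn] := eqVneq m n; first by rewrite !subrr expr0n !mulr0.
set x : R := Num.sqrt m%:R; set y : R := Num.sqrt n%:R.
have ex : m%:R = x ^+ 2 :> R by rewrite sqr_sqrtr.
have ey : n%:R = y ^+ 2 :> R by rewrite sqr_sqrtr.
have x0 : 0 <= x by exact: sqrtr_ge0.
have y0 : 0 <= y by exact: sqrtr_ge0.
have xy1 : 1 <= x ^+ 2 + y ^+ 2.
  by rewrite -ex -ey -natrD ler1n; case: m n mn {x y ex ey x0 y0} => [|m] [|n].
rewrite -natr1 ex ey.
have -> : 2 * (x ^+ 2 - y ^+ 2) ^+ 2 = (2 * (x + y) ^+ 2) * (x - y) ^+ 2 by ring.
by apply: ler_wpM2r; [exact: sqr_ge0|have := mulr_ge0 x0 y0; nra].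
Qed.

(** Chebyshev's inequality: indices within [delta] of [n] cost [eps], the others at most [2 * C]
    times a mass controlled by the second moment. *)
Lemma heat_small_time t f C eps delta n : 0 < t -> t <= 1 -> bounded_by C f ->
  0 < delta -> 0 <= eps ->
  (forall m k, rho R m k <= delta -> `|f m - f k| <= eps) ->
  `|heat t f n - f n| <= eps + 16 * C * t / delta ^+ 2.
Proof.
move=> t0 t1 fC d0 e0 fe; have C0 := bounded_by_ge0 fC.
have pp := heat_param t0.
have wp := heat_weight n t0.
have cb : bounded_by `|f n| (fun=> f n) by [].
have -> : heat t f n - f n = mean (kern (t / (1 + t)) n) (f \- (fun=> f n)).
  by rewrite (meanB wp fC cb) mean_const.
have dd : 0 < delta ^+ 2 by rewrite exprn_gt0.
apply: (cvgn_norm_le (mean_cvg wp (bounded_byB fC cb))) => N.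
rewrite /series/=; apply: (le_trans (ler_norm_sum _ _ _)).
(* Chosen so that [2 * C <= c * (m - n)^2] whenever [rho m n > delta], by [sqrt_dist_le]. *)
pose c := 4 * C / (delta ^+ 2 * n.+1%:R).
have c0 : 0 <= c by rewrite divr_ge0 ?mulr_ge0// ltW.
apply: (@le_trans _ _ (\sum_(0 <= m < N)
    (kern (t / (1 + t)) n m * eps + c * (kern (t / (1 + t)) n m * (m%:R - n%:R) ^+ 2)))).
  apply: ler_sum => m _; rewrite normrM (ger0_norm (kern_ge0 _ _ pp)).
  rewrite [c * _]mulrCA -mulrDr ler_wpM2l ?kern_ge0//=.
  have q0 : 0 <= c * (m%:R - n%:R) ^+ 2 by rewrite mulr_ge0// sqr_ge0.
  have [h|h] := leP (rho R m n) delta; first by rewrite (le_trans (fe _ _ h))// lerDl.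
  apply: (@le_trans _ _ (c * (m%:R - n%:R) ^+ 2)); last by rewrite lerDr.
  apply: (@le_trans _ _ (2 * C)).
    by rewrite (le_trans (ler_normB _ _))// mulr_natl mulr2n lerD.
  have := sqrt_dist_le m n; rewrite -real_normK ?num_real// -/(rho R m n) => h'.
  have h2 : delta ^+ 2 <= rho R m n ^+ 2 by apply: lerXn2r (ltW h); rewrite nnegrE ?normr_ge0// ltW.
  rewrite /c mulrAC ler_pdivlMr ?mulr_gt0//.
  have := ler_wpM2l (ler0n R n.+1) h2 => h3.
  have := ler_wpM2l (mulr_ge0 (ler0n R 2) C0) (le_trans h3 h'); lra.
rewrite big_split/= -mulr_suml -mulr_sumr lerD//.
  by rewrite ler_piMl// weight_sum_le1.
apply: (le_trans (ler_wpM2l c0 (kern_second_moment n N pp))).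
have -> : t / (1 + t) / (1 - t / (1 + t)) = t.
  have h1 : 1 + t != 0 by rewrite gt_eqF// addr_gt0.
  have -> : 1 - t / (1 + t) = (1 + t)^-1 by field.
  by field.
rewrite /c mulrAC ler_pdivrMr ?mulr_gt0//.
have -> : 16 * C * t / delta ^+ 2 * (delta ^+ 2 * n.+1%:R) = 4 * C * (t * (4 * n.+1%:R)).
  by move: (n.+1%:R : R) => x; field; rewrite gt_eqF.
rewrite ler_wpM2l ?mulr_ge0// -natr1.
have := ler0n R n; set x := n%:R => x0.
have h1 : t ^+ 2 <= t by rewrite expr2 ler_piMr// ltW.
have := mulr_ge0 x0 (ltW t0); lra.
Qed.

Lemma heat_dense_in_RO f C eps : bounded_by C f ->
  (forall e, 0 < e -> exists2 delta, 0 < delta &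
     forall m k, rho R m k <= delta -> `|f m - f k| <= e) -> 0 < eps ->
  exists2 g, is_bounded g & forall n, `|f n - heat 1 g n| <= eps.
Proof.
move=> fC fu e0; have C0 := bounded_by_ge0 fC.
have e3 : 0 < eps / 3 by rewrite divr_gt0.
have [d d0 hd] := fu _ e3.
pose K := 16 * C / d ^+ 2.
have K0 : 0 <= K by rewrite divr_ge0 ?mulr_ge0// ltW// exprn_gt0.
(* The denominator [K + 1] stays positive when [K = 0] and still gives [K * t <= eps / 3]. *)
pose t := Num.min 1 (eps / 3 / (K + 1)).
have t0 : 0 < t by rewrite lt_min ltr01/= divr_gt0// ltr_wpDl.
have t1 : t <= 1 by rewrite ge_min lexx.
have Kt : K * t <= eps / 3.
  apply: (@le_trans _ _ ((K + 1) * t)); first by rewrite ler_wpM2r ?ltW// ltrDl.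
  by rewrite mulrC -ler_pdivlMr ?ltr_wpDl// ge_min lexx orbT.
have [g gb hg] := heat_range_dense t0 (ex_intro _ C fC) e3.
exists g => // n.
have := heat_small_time n t0 t1 fC d0 (ltW e3) hd.
have -> : 16 * C * t / d ^+ 2 = K * t by rewrite /K mulrAC.
rewrite distrC => h1; have := hg n => h2.
have -> : f n - heat 1 g n = (f n - heat t f n) + (heat t f n - heat 1 g n).
  by rewrite addrA subrK.
apply: (le_trans (ler_normD _ _)); lra.
Qed.

End SmallTime.

(** * Square roots and null sets *)

Section SqrtNull.
Context {R : realType}.
Notation mu := (@lebesgue_measure R).

Lemma measurable_Rplus : measurable (@Rplus R : set (measurableTypeR R)).
Proof. exact: measurable_itv. Qed.

Lemma measurable_sqrt (D : set R) : measurable_fun D (@Num.sqrt R).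
Proof. by apply: measurable_funTS; apply: continuous_measurable_fun; exact: sqrt_continuous. Qed.

(** The preimage lies in [[c^2, d^2]], of length [(d - c) * (d + c)], where [c] and [d] are the ends
    of []a, b]] clipped to [[0, K]]. *)
Lemma sqrt_preimage_itv_le (a b K : R) : 0 <= K -> a < b ->
  (mu (@Rplus R `&` Num.sqrt @^-1` (`]a, b] `&` `]-oo, K])) <= (2 * K)%:E * mu `]a, b])%E.
Proof.
move=> K0 ab.
pose c := Num.max a 0; pose d := Num.min b K.
have sub : @Rplus R `&` Num.sqrt @^-1` (`]a, b] `&` `]-oo, K]) `<=`
    `[c ^+ 2, d ^+ 2] `&` [set _ | c <= d].
  move=> r [/=]; rewrite /Rplus /= !in_itv/= andbT => r0 [/andP[ar rb] rK].
  have cr : c <= Num.sqrt r by rewrite /c ge_max sqrtr_ge0 (ltW ar).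
  have rd : Num.sqrt r <= d by rewrite /d le_min rb.
  have c0 : 0 <= c by rewrite /c le_max lexx orbT.
  split; last exact: le_trans cr rd.
  rewrite -(sqr_sqrtr r0); apply/andP; split; rewrite lerXn2r ?nnegrE ?sqrtr_ge0//.
  by rewrite (le_trans c0)// (le_trans cr).
have mS : measurable (@Rplus R `&` Num.sqrt @^-1` (`]a, b] `&` `]-oo, K])).
  apply: measurable_sqrt; first exact: measurable_Rplus.
  by apply: measurableI; exact: measurable_itv.
have muab : mu `]a, b] = (b - a)%:E by rewrite lebesgue_measure_itv/= lte_fin ab EFinN.
rewrite muab -EFinM.
have [cd|dc] := leP c d; last first.
  rewrite (_ : _ `&` _ = set0) ?measure0 ?lee_fin ?mulr_ge0 ?subr_ge0 ?(ltW ab)//.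
  by rewrite -subset0 => r /sub [_ /=]; rewrite leNgt dc.
apply: (@le_trans _ _ (mu `[c ^+ 2, d ^+ 2])).
  by apply: le_measure; rewrite ?inE// => r /sub [].
rewrite lebesgue_measure_itv/= lte_fin; case: ifPn => _; last first.
  by rewrite lee_fin mulr_ge0 ?subr_ge0 ?(ltW ab)// mulr_ge0.
rewrite -EFinB lee_fin subr_sqr mulrC.
have c0 : 0 <= c by rewrite /c le_max lexx orbT.
have dK : d <= K by rewrite /d ge_min lexx orbT.
have db : d <= b by rewrite /d ge_min lexx.
have ac : a <= c by rewrite /c le_max lexx.
by apply: ler_pM; lra.
Qed.

(** A symbol is bounded almost everywhere in [x], but the integral evaluates it at [sqrt r]. Null
    sets pull back to null sets because squaring is Lipschitz on each [[0, K]]. *)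
Lemma sqrt_preimage_negligible (N : set R) : mu.-negligible N ->
  mu.-negligible (@Rplus R `&` Num.sqrt @^-1` N).
Proof.
move=> [A [mA A0 NA]].
pose Z (K : nat) := @Rplus R `&` Num.sqrt @^-1` (A `&` `]-oo, K%:R]).
suff: mu.-negligible (\bigcup_K Z K).
  apply: negligibleS.
  move=> r [r0 Nr]; exists (Num.bound (Num.sqrt r)) => //; split => //; split.
    exact: NA.
  by rewrite /= in_itv/= ltW// archi_boundP// sqrtr_ge0.
apply: negligible_bigcup => K.
have mZ : measurable (Z K).
  apply: measurable_sqrt; first exact: measurable_Rplus.
  by apply: measurableI => //; exact: measurable_itv.
apply/negligibleP => //; apply/eqP; rewrite eq_le measure_ge0 andbT.
apply/lee_addgt0Pr => e e0; rewrite add0e.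
(* The added [1] keeps the denominator positive at [K = 0], and [2 * K * e' <= e]. *)
pose e' := e / (2 * K%:R + 1).
have K1 : 0 < 2 * K%:R + 1 :> R by rewrite ltr_wpDl// mulr_ge0.
have e'0 : 0 < e' by rewrite divr_gt0.
have : (mu A < mu A + e'%:E)%E by rewrite A0 add0e lte_fin.
(* Lebesgue measure is an infimum over countable covers by half-open intervals; one of total length
   below [e'] is selected. *)
move=> /ereal_inf_lt[z [/= I [mI AI] sIz zle]].
have oI k : ocitv (I k) by have := mI k.
have mI' k : measurable (I k : set R).
  by have /ocitvP[->|[[a b] /= ab ->]] := oI k; [exact: measurable0|exact: measurable_itv].
pose B k := @Rplus R `&` Num.sqrt @^-1` ((I k : set R) `&` `]-oo, K%:R]).
have mB k : measurable (B k).
  apply: measurable_sqrt; first exact: measurable_Rplus.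
  by apply: measurableI => //; exact: measurable_itv.
have muB k : (mu (B k) <= (2 * K%:R)%:E * mu (I k : set R))%E.
  rewrite /B; have /ocitvP[->|[[a b] /= ab ->]] := oI k.
    by rewrite set0I preimage_set0 setI0 !measure0 mule0.
  exact: sqrt_preimage_itv_le.
apply: (@le_trans _ _ (\sum_(k <oo) mu (B k))%E).
  apply: measure_sigma_subadditive => //.
  move=> r [r0 [Ar rK]]; have [k _ Ikr] := AI _ Ar.
  by exists k.
apply: (@le_trans _ _ (\sum_(k <oo) (2 * K%:R)%:E * mu (I k : set R))%E).
  by apply: lee_nneseries.
rewrite nneseriesZl//.
apply: (@le_trans _ _ ((2 * K%:R)%:E * e'%:E)%E).
  rewrite lee_wpmul2l ?lee_fin ?mulr_ge0//.
  move: zle; rewrite A0 add0e => /ltW; apply: le_trans.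
  rewrite -sIz; apply: lee_nneseries => // k _.
  have /ocitvP[->|[[a b] /= ab ->]] := oI k; first by rewrite measure0 wlength0.
  by rewrite lebesgue_measure_itv/= lte_fin ab wlength_itv_bnd// ltW.
rewrite -EFinM lee_fin /e' mulrA ler_pdivrMr// mulrC ler_wpM2l ?(ltW e0)//.
by rewrite lerDl.
Qed.

End SqrtNull.

(** * Gamma integrals *)

Section GammaIntegral.
Context {R : realType}.
Notation mu := (@lebesgue_measure R).
Implicit Types (c r x : R) (n : nat).

Definition powexp c n r : R := r ^+ n * expR (- (c * r)).

Lemma powexp_ge0 c n r : 0 <= r -> 0 <= powexp c n r.
Proof. by move=> r0; rewrite mulr_ge0 ?exprn_ge0 ?expR_ge0. Qed.

Lemma is_derive_powexp c n x :
  is_derive x 1 (powexp c n) (n%:R * x ^+ n.-1 * expR (- (c * x)) - c * powexp c n x).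
Proof.
have dp : is_derive x 1 (fun y : R => y ^+ n) (n%:R * x ^+ n.-1).
  have := is_deriveX n (is_derive_id x (1 : R)).
  by rewrite exprfctE /GRing.scale/= mulr1.
have dl : is_derive x 1 (fun y : R => - (c * y)) (- c).
  have := is_deriveZ (- c) (is_derive_id x (1 : R)).
  rewrite /GRing.scale/= mulr1.
  have -> // : - c \*: id = (fun y : R => - (c * y)).
  by apply/funext => y /=; rewrite /GRing.scale/= mulNr.
have de := @is_derive1_comp R expR (fun y => - (c * y)) x _ _ (is_derive_expR _) dl.
apply: (is_derive_eq (is_deriveM dp de)).
by rewrite /GRing.scale/= /powexp; ring.
Qed.

Lemma powexp_continuous c n : continuous (powexp c n).
Proof.
move=> x; apply: differentiable_continuous; apply/derivable1_diffP.
by have [] := is_derive_powexp c n x.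
Qed.

Lemma measurable_powexp c n (D : set R) : measurable_fun D (powexp c n).
Proof.
by apply: measurable_funTS; apply: continuous_measurable_fun; exact: powexp_continuous.
Qed.

(** The exponential dominates the single term [(c * r) ^+ n.+1 / n.+1!] of its series, one degree
    above the power. *)
Lemma powexp_cvgy c n : 0 < c -> powexp c n r @[r --> +oo] --> (0 : R).
Proof.
move=> c0; apply/cvgr0Pnorm_le => e e0.
pose K : R := (n.+1)`!%:R / c ^+ n.+1.
have K0 : 0 < K by rewrite divr_gt0 ?exprn_gt0// ltr0n fact_gt0.
near=> r.
have r0 : 0 < r by near: r; apply: nbhs_pinfty_gt; rewrite num_real.
have rK : K / e <= r by near: r; apply: nbhs_pinfty_ge; rewrite num_real.
rewrite ger0_norm ?powexp_ge0 ?(ltW r0)// /powexp expRN ler_pdivrMr ?expR_gt0//.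
have cr0 : 0 <= c * r by rewrite mulr_ge0// ltW.
have h := expR_ge1Dxn n cr0.
apply: (@le_trans _ _ (e * ((c * r) ^+ n.+1 / (n.+1)`!%:R))); last first.
  by rewrite ler_pM2l// (le_trans _ h)// lerDr.
have -> : (c * r) ^+ n.+1 / (n.+1)`!%:R = r ^+ n * r / K.
  have f0 : (n.+1)`!%:R != 0 :> R by rewrite pnatr_eq0 -lt0n fact_gt0.
  rewrite /K exprMn [r ^+ n.+1]exprSr; have : c ^+ n.+1 != 0 by rewrite expf_neq0// gt_eqF.
  move: ((n.+1)`!%:R) f0 (r ^+ n) (c ^+ n.+1) => F F0 x y y0; field.
  by rewrite F0 y0.
have h1 : 1 <= e * r / K.
  by rewrite ler_pdivlMr// mul1r mulrC -ler_pdivrMr.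
have -> : e * (r ^+ n * r / K) = r ^+ n * (e * r / K) by ring.
by rewrite ler_peMr// exprn_ge0// ltW.
Unshelve. all: by end_near. Qed.

(** Repeated integration by parts, normalised to vanish at infinity for [c > 0]. *)
Fixpoint powexp_primitive c n r : R :=
  if n is n'.+1 then n%:R / c * powexp_primitive c n' r - powexp c n r / c
  else - (powexp c 0 r / c).

Lemma is_derive_powexp_primitive c n x : c != 0 ->
  is_derive x 1 (powexp_primitive c n) (powexp c n x).
Proof.
move=> c0; elim: n => [|n IHn] /=.
  have := is_deriveZ (- c^-1) (is_derive_powexp c 0 x).
  have -> : - c^-1 \*: powexp c 0 = (fun y => - (powexp c 0 y / c)).
    by apply/funext => y; rewrite /= /GRing.scale/= mulNr mulrC.
  rewrite /GRing.scale/= => h; apply: (is_derive_eq h).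
  by rewrite mul0r mul0r sub0r mulrNN mulKf.
have := is_deriveB (is_deriveZ (n.+1%:R / c) IHn) (is_deriveZ c^-1 (is_derive_powexp c n.+1 x)).
have -> : n.+1%:R / c \*: powexp_primitive c n - c^-1 \*: powexp c n.+1 =
    (fun y => n.+1%:R / c * powexp_primitive c n y - powexp c n.+1 y / c).
  apply/funext => y.
  rewrite -[LHS]/(n.+1%:R / c * powexp_primitive c n y - c^-1 * powexp c n.+1 y).
  by rewrite [c^-1 * _]mulrC.
rewrite /GRing.scale/= => h; apply: (is_derive_eq h).
by rewrite /powexp/=; field.
Qed.

Lemma powexp_primitive_cvgy c n : 0 < c ->
  powexp_primitive c n r @[r --> +oo] --> (0 : R).
Proof.
move=> c0; elim: n => [|n IHn] /=.
  rewrite [X in _ --> X](_ : 0 = - (0 * c^-1)); last by rewrite mul0r oppr0.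
  by apply: cvgN; apply: cvgMr_tmp; exact: powexp_cvgy.
rewrite [X in _ --> X](_ : 0 = n.+1%:R / c * 0 - 0 * c^-1); last first.
  by rewrite mulr0 mul0r subr0.
by apply: cvgB; [exact: cvgMl_tmp|apply: cvgMr_tmp; exact: powexp_cvgy].
Qed.

Lemma powexp_primitive0 c n : c != 0 ->
  powexp_primitive c n 0 = - (n`!%:R / c ^+ n.+1).
Proof.
move=> c0; elim: n => [|n IHn] /=.
  by rewrite /powexp expr0 mul1r mulr0 oppr0 expR0 expr1.
rewrite IHn /powexp expr0n/= !mul0r subr0 factS natrM [c ^+ n.+2]exprS invfM; ring.
Qed.

Lemma integral_powexp c n : 0 < c ->
  (\int[mu]_(r in @Rplus R) (powexp c n r)%:E = (n`!%:R / c ^+ n.+1)%:E)%E.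
Proof.
move=> c0; have c0' : c != 0 by rewrite gt_eqF.
have dF x : derivable (powexp_primitive c n) x 1.
  by have [] := is_derive_powexp_primitive n x c0'.
rewrite /Rplus (ge0_continuous_FTC2y (F := powexp_primitive c n) (l := 0)).
- by rewrite powexp_primitive0// -EFinB sub0r opprK.
- by move=> x; exact: powexp_ge0.
- by apply: continuous_subspaceT; exact: powexp_continuous.
- exact: powexp_primitive_cvgy.
- by [].
- apply: cvg_at_right_filter; apply: differentiable_continuous.
  exact/derivable1_diffP.
- move=> x _; rewrite derive1E.
  by have [_ ->] := is_derive_powexp_primitive n x c0'.
Qed.

Lemma integrable_powexp c n : 0 < c ->
  mu.-integrable (@Rplus R) (EFin \o powexp c n).
Proof.
move=> c0; apply/integrableP; split.
  by apply/measurable_EFinP; exact: measurable_powexp.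
have -> : (\int[mu]_(r in @Rplus R) `|(EFin \o powexp c n) r| =
    \int[mu]_(r in @Rplus R) (powexp c n r)%:E)%E.
  apply: eq_integral => r; rewrite inE /Rplus/= in_itv/= andbT => r0.
  by rewrite ger0_norm// powexp_ge0.
by rewrite integral_powexp// ltry.
Qed.

End GammaIntegral.

(** * Gamma averages and their increments *)

Section GammaMean.
Context {R : realType}.
Notation mu := (@lebesgue_measure R).
Implicit Types (A : R -> R) (M r : R) (n : nat).

(* The Gamma density in r for fixed n, and the Poisson weight in n for fixed r. *)
Definition gammaw n r : R := expR (- r) * r ^+ n / n`!%:R.

Definition gamma_mean A n : R := \int[mu]_(r in @Rplus R) (A r * gammaw n r).

Lemma RplusE r : Rplus r = (0 <= r) :> Prop.
Proof. by rewrite /Rplus/= in_itv/= andbT. Qed.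

Lemma gammawE n : gammaw n = (fun r => n`!%:R^-1 * powexp 1 n r).
Proof. by apply/funext => r; rewrite /gammaw /powexp mul1r; ring. Qed.

Lemma gammaw_ge0 n r : 0 <= r -> 0 <= gammaw n r.
Proof. by move=> r0; rewrite !mulr_ge0 ?expR_ge0 ?exprn_ge0 ?invr_ge0. Qed.

Lemma fact_neq0 n : n`!%:R != 0 :> R.
Proof. by rewrite pnatr_eq0 -lt0n fact_gt0. Qed.

Lemma measurable_gammaw n (D : set R) : measurable_fun D (gammaw n).
Proof. by rewrite gammawE; apply: measurable_funM => //; exact: measurable_powexp. Qed.

Lemma integrable_gammaw n : mu.-integrable (@Rplus R) (EFin \o gammaw n).
Proof.
rewrite gammawE.
exact: (@integrableZl _ _ _ mu _ measurable_Rplus n`!%:R^-1 _ (integrable_powexp n (@ltr01 R))).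
Qed.

Lemma Rintegral_gammaw n : \int[mu]_(r in @Rplus R) gammaw n r = 1.
Proof.
rewrite gammawE RintegralZl; [|exact: measurable_Rplus|exact: integrable_powexp].
by rewrite /Rintegral integral_powexp//= expr1n divr1 mulVf// fact_neq0.
Qed.

Lemma gammawS n r : r * gammaw n r = n.+1%:R * gammaw n.+1 r.
Proof.
rewrite /gammaw factS natrM exprS.
have := fact_neq0 n; have : n.+1%:R != 0 :> R by rewrite pnatr_eq0.
move: (n.+1%:R : R) (n`!%:R : R) => x y x0 y0; field.
by rewrite x0 y0.
Qed.

Lemma integrable_mul_gammaw A M n : measurable_fun (@Rplus R) A ->
  (forall r, 0 <= r -> `|A r| <= M) ->
  mu.-integrable (@Rplus R) (fun r => (A r * gammaw n r)%:E).
Proof.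
move=> mA AM.
have := integrableZl measurable_Rplus M (integrable_gammaw n).
apply: le_integrable; first exact: measurable_Rplus.
  by apply/measurable_EFinP; apply: measurable_funM => //; exact: measurable_gammaw.
move=> r; rewrite RplusE => r0.
rewrite /= lee_fin !normrM ler_wpM2r// (le_trans (AM _ r0))// ler_norm//.
Qed.

Lemma gamma_mean_norm A M n : measurable_fun (@Rplus R) A ->
  (forall r, 0 <= r -> `|A r| <= M) -> `|gamma_mean A n| <= M.
Proof.
move=> mA AM; have iA := integrable_mul_gammaw n mA AM.
apply: (le_trans (le_normr_Rintegral measurable_Rplus iA)).
apply: (@le_trans _ _ (\int[mu]_(r in @Rplus R) (M * gammaw n r))).
  apply: le_Rintegral => //.
  - exact: measurable_Rplus.
  - exact: integrable_norm.
  - exact: (integrableZl measurable_Rplus M (integrable_gammaw n)).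
  - move=> r; rewrite RplusE => r0.
    by rewrite normrM [`|gammaw _ _|]ger0_norm ?gammaw_ge0// ler_wpM2r ?AM ?gammaw_ge0.
rewrite RintegralZl ?Rintegral_gammaw ?mulr1//; first exact: measurable_Rplus.
exact: integrable_gammaw.
Qed.

(** With [u = r / n.+1 - 1], the difference of densities is [u * gammaw n], and [u] has mean square
    [1 / n.+1]. Cauchy-Schwarz appears pointwise as [|u| <= s / 2 * u^2 + 1 / (2 * s)] with
    [s = sqrt n.+1]. *)
Lemma gamma_mean_increment A M n : measurable_fun (@Rplus R) A ->
  (forall r, 0 <= r -> `|A r| <= M) ->
  `|gamma_mean A n.+1 - gamma_mean A n| <= M / Num.sqrt n.+1%:R.
Proof.
move=> mA AM; have M0 : 0 <= M by apply: le_trans (AM 0 (lexx _)).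
set s := Num.sqrt n.+1%:R.
have s0 : 0 < s by rewrite sqrtr_gt0 ltr0n.
have ss : n.+1%:R = s ^+ 2 :> R by rewrite sqr_sqrtr.
have mR := @measurable_Rplus R.
have iA := integrable_mul_gammaw n mA AM.
have iA' := integrable_mul_gammaw n.+1 mA AM.
rewrite /gamma_mean -RintegralB//.
have iB : mu.-integrable (@Rplus R) (EFin \o (fun r => A r * gammaw n.+1 r - A r * gammaw n r)).
  by have := integrableB mR iA' iA; exact: eq_integrable.
apply: (le_trans (le_normr_Rintegral mR iB)).
have i0 := integrable_gammaw n.
have i1 := integrable_gammaw n.+1.
have i2 := integrable_gammaw n.+2.
have iZ k c : mu.-integrable (@Rplus R) (EFin \o (fun r => c * gammaw k r)).
  exact: (integrableZl mR c (integrable_gammaw k)).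
(* The majorant [M * (s / 2 * u^2 + 1 / (2 * s)) * gammaw n] is a combination of three Gamma
   densities with coefficients [a], [b], [c]; its integral is then [a + b + c]. *)
pose a := M * (s / 2 * (n.+2%:R / n.+1%:R)).
pose b := - (M * s).
pose c := M * (s / 2 + (2 * s)^-1).
have iab : mu.-integrable (@Rplus R) (EFin \o (fun r => a * gammaw n.+2 r + b * gammaw n.+1 r)).
  by have := integrableD mR (iZ n.+2 a) (iZ n.+1 b); exact: eq_integrable.
have iabc : mu.-integrable (@Rplus R)
   (EFin \o (fun r => a * gammaw n.+2 r + b * gammaw n.+1 r + c * gammaw n r)).
  by have := integrableD mR iab (iZ n c); exact: eq_integrable.
apply: (@le_trans _ _ (\int[mu]_(r in @Rplus R)
    (a * gammaw n.+2 r + b * gammaw n.+1 r + c * gammaw n r))).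
  apply: le_Rintegral => //; first exact: integrable_norm.
  move=> r; rewrite RplusE => r0.
  have g0 := gammaw_ge0 n r0.
  have n10 : n.+1%:R != 0 :> R by rewrite pnatr_eq0.
  have n20 : n.+2%:R != 0 :> R by rewrite pnatr_eq0.
  pose u := r / s ^+ 2 - 1.
  have e1 : gammaw n.+1 r = gammaw n r * (u + 1).
    by rewrite /u subrK -ss mulrCA mulrA gammawS mulrAC divff// mul1r.
  have e2 : n.+2%:R / n.+1%:R * gammaw n.+2 r = gammaw n r * (u + 1) ^+ 2.
    have -> : n.+2%:R / n.+1%:R * gammaw n.+2 r = r / n.+1%:R * gammaw n.+1 r.
      by rewrite mulrAC -gammawS mulrAC.
    by rewrite e1 /u subrK -ss; ring.
  rewrite -mulrBr normrM.
  apply: (@le_trans _ _ (M * `|gammaw n.+1 r - gammaw n r|)); first by rewrite ler_wpM2r ?AM.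
  have -> : a * gammaw n.+2 r + b * gammaw n.+1 r + c * gammaw n r =
      M * (s / 2 * (n.+2%:R / n.+1%:R * gammaw n.+2 r) - s * gammaw n.+1 r +
           (s / 2 + (2 * s)^-1) * gammaw n r).
    rewrite /a /b /c; move: (gammaw _ _) (gammaw _ _) (gammaw _ _) (n.+2%:R / n.+1%:R) => x y z t.
    by ring.
  rewrite e2 e1 ler_wpM2l//.
  have -> : gammaw n r * (u + 1) - gammaw n r = gammaw n r * u by ring.
  rewrite normrM ger0_norm//.
  have -> : s / 2 * (gammaw n r * (u + 1) ^+ 2) - s * (gammaw n r * (u + 1)) +
      (s / 2 + (2 * s)^-1) * gammaw n r =
      gammaw n r * (s / 2 * u ^+ 2 + (2 * s)^-1) by field; rewrite gt_eqF.
  rewrite ler_wpM2l// -[u ^+ 2]real_normK ?num_real//; set v := `|u|.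
  rewrite -subr_ge0.
  have -> : s / 2 * v ^+ 2 + (2 * s)^-1 - v = (s * v - 1) ^+ 2 / (2 * s).
    by field; rewrite gt_eqF.
  by rewrite divr_ge0 ?sqr_ge0// mulr_ge0// ltW.
rewrite RintegralD// RintegralD// !RintegralZl// !Rintegral_gammaw !mulr1.
rewrite le_eqVlt; apply/orP; left; apply/eqP.
rewrite /a /b /c; have -> : n.+2%:R = n.+1%:R + 1 :> R by rewrite natr1.
by rewrite ss; field; rewrite gt_eqF.
Qed.

(** Sum the increments, using [1 / sqrt k.+1 <= 2 * (sqrt k.+1 - sqrt k)]. *)
Lemma sqrt_lipschitz_of_increments (g : nat -> R) M :
  (forall n, `|g n.+1 - g n| <= M / Num.sqrt n.+1%:R) ->
  forall m n, `|g m - g n| <= 2 * M * rho R m n.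
Proof.
move=> gM.
have M0 : 0 <= M by have := gM 0%N; rewrite sqrtr1 divr1; exact: le_trans.
have h m d : `|g (m + d)%N - g m| <= 2 * M * (Num.sqrt (m + d)%:R - Num.sqrt m%:R).
  elim: d => [|d IHd]; first by rewrite addn0 !subrr normr0 mulr0.
  rewrite addnS; set k := (m + d)%N in IHd *.
  have -> : g k.+1 - g m = (g k.+1 - g k) + (g k - g m) by rewrite addrA subrK.
  apply: (le_trans (ler_normD _ _)).
  apply: (le_trans (lerD (gM k) IHd)).
  rewrite -subr_ge0.
  set x := Num.sqrt k%:R; set y := Num.sqrt k.+1%:R; set z := Num.sqrt m%:R.
  have y0 : 0 < y by rewrite sqrtr_gt0 ltr0n.
  have x0 : 0 <= x by exact: sqrtr_ge0.
  have yx : y ^+ 2 = x ^+ 2 + 1 by rewrite !sqr_sqrtr// natr1.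
  have xy : x <= y by rewrite ler_wsqrtr// ler_nat.
  have -> : 2 * M * (y - z) - (M / y + 2 * M * (x - z)) = M * ((y - x) ^+ 2 / y).
    have -> : M / y = M * (y ^+ 2 - x ^+ 2) / y by rewrite yx addrAC subrr add0r mulr1.
    by field; rewrite gt_eqF.
  by rewrite mulr_ge0// divr_ge0 ?sqr_ge0// ltW.
move=> m n; wlog mn : m n / (n <= m)%N => [hw|].
  have [|/ltnW] := leqP n m; first exact: hw.
  by move=> /hw; rewrite distrC /rho [X in _ <= _ * X]distrC.
have := h n (m - n)%N; rewrite subnKC// => hh; apply: (le_trans hh).
by rewrite ler_wpM2l ?mulr_ge0// ler_norm.
Qed.

End GammaMean.

(** * Poisson averages as symbols *)

Section Husimi.
Context {R : realType}.
Notation mu := (@lebesgue_measure R).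
Implicit Types (f g : nat -> R) (C r z : R) (n m : nat).

(** The average under the Poisson law of parameter [r]: the Husimi (Berezin) function, at
    [|z|^2 = r], of the diagonal operator with eigenvalues [g]. *)
Definition husimi g r : R := mean (gammaw ^~ r) g.

Lemma exp_series (y : R) : series (fun m => y ^+ m / m`!%:R) @ \oo --> expR y.
Proof. exact: is_cvg_series_exp_coeff. Qed.

Lemma poisson_pow r z :
  series (fun m => gammaw m r * z ^+ m) @ \oo --> expR (- (r * (1 - z))).
Proof.
have -> : series (fun m => gammaw m r * z ^+ m) =
    (fun N => expR (- r) * series (fun m => (r * z) ^+ m / m`!%:R) N).
  apply/funext => N; rewrite /series/= mulr_sumr; apply: eq_bigr => m _.
  by rewrite /gammaw exprMn; ring.
have -> : - (r * (1 - z)) = - r + r * z by ring.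
by rewrite expRD; apply: cvgMl_tmp; exact: exp_series.
Qed.

Lemma poisson_weight r : 0 <= r -> weight (@gammaw R ^~ r).
Proof.
move=> r0; split=> [m|]; first exact: gammaw_ge0.
have := @poisson_pow r 1; rewrite subrr mulr0 oppr0 expR0.
have -> // : (fun m => gammaw m r * 1 ^+ m) = gammaw ^~ r.
by apply/funext => m; rewrite expr1n mulr1.
Qed.

Lemma husimi_bounded g C r : 0 <= r -> bounded_by C g -> `|husimi g r| <= C.
Proof. by move=> r0 gC; apply: mean_norm => //; exact: poisson_weight. Qed.

Lemma measurable_husimi g C (phi : R -> R) : bounded_by C g ->
  measurable_fun (@Rplus R) phi -> (forall r, 0 <= r -> 0 <= phi r) ->
  measurable_fun (@Rplus R) (husimi g \o phi).
Proof.
move=> gC mphi phi0.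
apply: (@measurable_fun_cvg _ _ _ _
   (fun N r => series (fun m => gammaw m (phi r) * g m) N)) => [N|r].
  rewrite /series/=; apply: measurable_sum => m.
  apply: measurable_funM => //.
  by apply: measurableT_comp => //; exact: measurable_gammaw.
by rewrite RplusE => r0; apply: (mean_cvg _ gC); apply: poisson_weight; exact: phi0.
Qed.

Lemma gamma_mean_exp z n : 0 <= z <= 1 ->
  gamma_mean (fun r => expR (- (r * (1 - z)))) n = ((2 - z) ^+ n.+1)^-1.
Proof.
move=> /andP[z0 z1]; have c0 : 0 < 2 - z by lra.
have -> : gamma_mean (fun r => expR (- (r * (1 - z)))) n =
    \int[mu]_(r in @Rplus R) (n`!%:R^-1 * powexp (2 - z) n r).
  apply: eq_Rintegral => r _; rewrite /gammaw /powexp.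
  have -> : - ((2 - z) * r) = - (r * (1 - z)) + - r by ring.
  by rewrite expRD; ring.
rewrite RintegralZl; [|exact: measurable_Rplus|exact: integrable_powexp].
rewrite /Rintegral integral_powexp//= mulrA mulVf ?mul1r//; exact: fact_neq0.
Qed.

(** Both sides are linear and continuous in [g], and at [z ^+ m] both equal
    [1 / (2 - z) ^+ n.+1]. *)
Lemma heat1_husimi g C n : bounded_by C g -> heat 1 g n = gamma_mean (husimi g) n.
Proof.
move=> gC; apply/eqP; rewrite eq_sym -subr_eq0; apply/eqP.
have mh f D : bounded_by D f -> measurable_fun (@Rplus R) (husimi f).
  move=> fD; apply: (@measurable_husimi f D id) => //.
have ih f D : bounded_by D f ->
    mu.-integrable (@Rplus R) (fun r => (husimi f r * gammaw n r)%:E).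
  move=> fD; apply: (@integrable_mul_gammaw _ _ D); first exact: mh fD.
  by move=> r r0; exact: husimi_bounded.
move: g C gC.
apply: (@eq0_of_vanishing_on_powers R (fun f => gamma_mean (husimi f) n - heat 1 f n)).
- move=> f g a C D fC gD.
  rewrite (heatD _ fC (bounded_byZ a gD))// (heatZ a _ gD)//.
  have -> : gamma_mean (husimi (f \+ a \*o g)) n =
      gamma_mean (husimi f) n + a * gamma_mean (husimi g) n.
    rewrite /gamma_mean -RintegralZl//; [|exact: measurable_Rplus|exact: ih gD].
    rewrite -RintegralD//; [|exact: measurable_Rplus|exact: ih fC|]; last first.
      exact: (integrableZl measurable_Rplus a (ih _ _ gD)).
    apply: eq_Rintegral => r; rewrite inE RplusE => r0.
    have wr := poisson_weight r0.
    rewrite /husimi (meanD wr fC (bounded_byZ a gD)) (meanZ a wr gD); ring.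
  by rewrite /=; ring.
- move=> f_ C fC f0; rewrite -(subrr 0); apply: cvgB; last first.
    by apply: (mean_tannery _ fC f0); exact: heat_weight.
  (* Continuity of the Gamma side combines Tannery at each [r] with dominated convergence, the
     majorant being [C * gammaw n]. *)
  pose F_ k r : \bar R := (husimi (f_ k) r * gammaw n r)%:E.
  have mF k : measurable_fun (@Rplus R) (F_ k).
    exact: (measurable_int mu (ih _ _ (fC k))).
  have F0 : {ae mu, forall r, Rplus r -> F_ ^~ r @ \oo --> 0%E}.
    apply: aeW => r; rewrite RplusE => r0.
    apply: cvg_EFin; first exact: nearW.
    have h := mean_tannery (poisson_weight r0) fC f0.
    rewrite -[X in _ --> X](mul0r (gammaw n r)); apply: cvgMr_tmp; exact: h.
  have ig := integrableZl measurable_Rplus C (integrable_gammaw n).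
  have Fg : {ae mu, forall r k, Rplus r -> (`|F_ k r| <= C%:E * (gammaw n r)%:E)%E}.
    apply: aeW => r k; rewrite RplusE => r0.
    rewrite /F_ -EFinM /= lee_fin normrM [`|gammaw _ _|]ger0_norm ?gammaw_ge0//.
    by rewrite ler_wpM2r ?gammaw_ge0// husimi_bounded.
  have [_ _] := dominated_convergence measurable_Rplus mF (measurable_cst 0%E) F0 ig Fg.
  by rewrite integral0 => /fine_cvg.
- move=> z /andP[/ltW z0 /ltW z1].
  have zz : 0 <= z <= 1 by rewrite z0.
  rewrite heat_pow// mul1r /=.
  have -> : husimi (fun m => z ^+ m) = (fun r => expR (- (r * (1 - z)))).
    by apply/funext => r; apply: mean_eq; exact: poisson_pow.
  rewrite gamma_mean_exp//; apply/eqP; rewrite subr_eq0; apply/eqP.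
  have c0 : 2 - z != 0 by rewrite gt_eqF//; lra.
  have -> : 1 + (1 - z) = 2 - z by ring.
  have -> : 1 - (1 - z) / (2 - z) = (2 - z)^-1 by field.
  by rewrite exprS invfM exprVn.
Qed.

End Husimi.

(** * Complex symbols *)

Section ComplexParts.
Context {R : rcfType}.
Implicit Types (z : R[i]) (x : R).

Lemma Re_mul_real z x : complex.Re (z * x%:C) = complex.Re z * x.
Proof. by case: z => a b; rewrite /= mulr0 subr0. Qed.

Lemma Im_mul_real z x : complex.Im (z * x%:C) = complex.Im z * x.
Proof. by case: z => a b; rewrite /= mulr0 add0r. Qed.

Lemma modulus_le z : modulus z <= `|complex.Re z| + `|complex.Im z|.
Proof.
case: z => a b /=; have ab0 : 0 <= `|a| + `|b| by rewrite addr_ge0.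
have -> : `|a| + `|b| = Num.sqrt ((`|a| + `|b|) ^+ 2) by rewrite sqrtr_sqr (ger0_norm ab0).
apply: ler_wsqrtr.
rewrite -[a ^+ 2]real_normK ?num_real// -[b ^+ 2]real_normK ?num_real//.
by rewrite sqrrD lerD2r lerDl mulrn_wge0// mulr_ge0.
Qed.

Lemma Re_le_modulus z : `|complex.Re z| <= modulus z.
Proof. by case: z => a b /=; rewrite -sqrtr_sqr ler_wsqrtr// lerDl sqr_ge0. Qed.

Lemma Im_le_modulus z : `|complex.Im z| <= modulus z.
Proof. by case: z => a b /=; rewrite -sqrtr_sqr ler_wsqrtr// lerDr sqr_ge0. Qed.

Lemma ReB z w : complex.Re (z - w) = complex.Re z - complex.Re w.
Proof. by case: z; case: w. Qed.

Lemma ImB z w : complex.Im (z - w) = complex.Im z - complex.Im w.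
Proof. by case: z; case: w. Qed.

Lemma natr_complexV n : (n%:R : R[i])^-1 = (n%:R^-1)%:C.
Proof. by rewrite -(rmorph_nat (real_complex R)) fmorphV. Qed.

End ComplexParts.

(** * Inclusion and density for complex sequences *)

Section Theorem7p3.
Context {R : realType}.
Notation mu := (@lebesgue_measure R).
Implicit Types (a : R -> R[i]) (sigma : nat -> R[i]) (A b : R -> R) (M : R).

Lemma gamma_meanE A M n : measurable_fun (@Rplus R) A ->
  (forall r, 0 <= r -> `|A r| <= M) ->
  n`!%:R^-1 * \int[mu]_(r in @Rplus R) (A r * (expR (- r) * r ^+ n)) =
  gamma_mean A n.
Proof.
move=> mA AM; rewrite /gamma_mean.
have -> : \int[mu]_(r in @Rplus R) (A r * (expR (- r) * r ^+ n)) =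
    \int[mu]_(r in @Rplus R) (n`!%:R * (A r * gammaw n r)).
  apply: eq_Rintegral => r _; rewrite /gammaw.
  by rewrite [RHS]mulrCA; congr (_ * _); rewrite [RHS]mulrC divfK// fact_neq0.
rewrite RintegralZl; [|exact: measurable_Rplus|exact: integrable_mul_gammaw mA AM].
by rewrite mulKf// fact_neq0.
Qed.

(** Clipping [b (sqrt r)] to [[- |M|, |M|]] changes it on a null set only, by
    [sqrt_preimage_negligible], and yields a bound valid everywhere. Using [|M|] keeps the interval
    nonempty without discussing the sign of [M]. *)
Lemma gamma_mean_ess_bounded b M : measurable_fun (@Rplus R) b ->
  {ae mu, forall r, Rplus r -> `|b r| <= M} ->
  exists A, [/\ measurable_fun (@Rplus R) A, forall r, 0 <= r -> `|A r| <= `|M| &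
    forall n, n`!%:R^-1 *
      \int[mu]_(r in @Rplus R) (b (Num.sqrt r) * (expR (- r) * r ^+ n)) =
      gamma_mean A n].
Proof.
move=> mb bM.
have mbs : measurable_fun (@Rplus R) (fun r => b (Num.sqrt r)).
  apply: (@measurable_comp _ _ _ _ _ _ (@Rplus R) b).
  - exact: measurable_Rplus.
  - by move=> _ [r _ <-]; rewrite RplusE sqrtr_ge0.
  - by [].
  - exact: measurable_sqrt.
pose A r := Num.max (- `|M|) (Num.min `|M| (b (Num.sqrt r))).
have mA : measurable_fun (@Rplus R) A.
  apply: (@measurable_maxr _ _ _ _ (fun=> - `|M|)); first exact: measurable_cst.
  by apply: (@measurable_minr _ _ _ _ (fun=> `|M|)) => //; exact: measurable_cst.
have M0 : - `|M| <= `|M| by rewrite (@le_trans _ _ 0)// oppr_le0.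
have AM r : 0 <= r -> `|A r| <= `|M|.
  by move=> _; rewrite ler_norml /A le_max lexx/= ge_max M0 ge_min lexx.
exists A; split => // n; rewrite -(gamma_meanE n mA AM); congr (_ * fine _).
have mw : measurable_fun (@Rplus R) (fun r : R => expR (- r) * r ^+ n).
  apply: measurable_funM; last by apply: measurable_funX.
  by apply: measurableT_comp => //; exact: measurable_funN.
apply: ae_eq_integral.
- exact: measurable_Rplus.
- by apply/measurable_EFinP; exact: measurable_funM.
- by apply/measurable_EFinP; exact: measurable_funM.
have N := sqrt_preimage_negligible bM.
apply: negligibleS N => r /= /not_implyP[Rr h]; split => //= bs; apply: h.
rewrite RplusE in Rr.
have {}bs : `|b (Num.sqrt r)| <= `|M|.
  by apply: le_trans (ler_norm _); apply: bs; rewrite RplusE sqrtr_ge0.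
have /andP[b1 b2] : - `|M| <= b (Num.sqrt r) <= `|M| by rewrite -ler_norml.
by rewrite /A (min_idPr b2) (max_idPr b1).
Qed.

Lemma Re_gamma_seq a n : complex.Re (gamma_seq a n) =
  n`!%:R^-1 * \int[mu]_(r in @Rplus R)
     (complex.Re (a (Num.sqrt r)) * (expR (- r) * r ^+ n)).
Proof.
rewrite /gamma_seq natr_complexV mulrC Re_mul_real mulrC /cintegral /=; congr (_ * _).
by apply: eq_Rintegral => r _; rewrite Re_mul_real.
Qed.

Lemma Im_gamma_seq a n : complex.Im (gamma_seq a n) =
  n`!%:R^-1 * \int[mu]_(r in @Rplus R)
     (complex.Im (a (Num.sqrt r)) * (expR (- r) * r ^+ n)).
Proof.
rewrite /gamma_seq natr_complexV mulrC Im_mul_real mulrC /cintegral /=; congr (_ * _).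
by apply: eq_Rintegral => r _; rewrite Im_mul_real.
Qed.

Lemma RO_of_lipschitz sigma C L :
  (forall n, modulus (sigma n) <= C) ->
  (forall m n, modulus (sigma n - sigma m) <= L * rho R m n) ->
  @RO R sigma.
Proof.
move=> sC sL; have L0 : 0 <= L.
  have := sL 0%N 1%N; rewrite /rho sqrtr0 sqrtr1 sub0r normrN1 mulr1.
  by apply: le_trans; apply: le_trans (Re_le_modulus _).
split.
  apply: (@le_lt_trans _ _ C%:E); last exact: ltry.
  by apply: ge_ereal_sup => _ [n _ <-]; rewrite lee_fin.
have h : ((L * d)%:E)%E @[d --> 0^'+] --> 0%E.
  apply: cvg_EFin; first exact: nearW.
  rewrite -[X in _ --> X](mulr0 L); apply: cvgMl_tmp.
  exact: cvg_at_right_filter cvg_id.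
apply: (squeeze_cvge _ (cvg_cst 0%E) h).
near=> d; have d0 : 0 < d by near: d; exact: nbhs_right_gt.
apply/andP; split.
  (* The pair [(0, 0)] is admissible, so the supremum is not [-oo] and is at least [0]. *)
  apply: (@le_trans _ _ (modulus (sigma 0%N - sigma 0%N))%:E).
    by rewrite lee_fin; apply: le_trans (Re_le_modulus _).
  by apply: ereal_sup_ubound; exists (0%N, 0%N) => //=; rewrite /rho subrr normr0 ltW.
apply: ge_ereal_sup => _ [[m n] /= mn <-]; rewrite lee_fin.
by rewrite (le_trans (sL m n))// ler_wpM2l.
Unshelve. all: by end_near. Qed.

Lemma frakG_subset_RO : @frakG R `<=` @RO R.
Proof.
move=> _ [a [mRe mIm [M aM]] <-].
have bR : {ae mu, forall r, Rplus r -> `|complex.Re (a r)| <= M}.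
  apply: negligibleS aM => r /= nh h; apply: nh => Rr.
  exact: le_trans (Re_le_modulus _) (h Rr).
have bI : {ae mu, forall r, Rplus r -> `|complex.Im (a r)| <= M}.
  apply: negligibleS aM => r /= nh h; apply: nh => Rr.
  exact: le_trans (Im_le_modulus _) (h Rr).
have [A [mA AM eA]] := gamma_mean_ess_bounded mRe bR.
have [B [mB BM eB]] := gamma_mean_ess_bounded mIm bI.
have eR n : complex.Re (gamma_seq a n) = gamma_mean A n by rewrite Re_gamma_seq eA.
have eI n : complex.Im (gamma_seq a n) = gamma_mean B n by rewrite Im_gamma_seq eB.
apply: (@RO_of_lipschitz _ (`|M| + `|M|) (2 * `|M| + 2 * `|M|)) => [n|m n].
  apply: (le_trans (modulus_le _)); rewrite eR eI.
  by apply: lerD; [exact: gamma_mean_norm mA AM|exact: gamma_mean_norm mB BM].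
apply: (le_trans (modulus_le _)); rewrite ReB ImB !eR !eI mulrDl.
rewrite distrC [`|gamma_mean B n - _|]distrC.
by apply: lerD; apply: sqrt_lipschitz_of_increments => k;
  [exact: gamma_mean_increment mA AM|exact: gamma_mean_increment mB BM].
Qed.

Lemma RO_bounded sigma : @RO R sigma -> exists C, forall n, modulus (sigma n) <= C.
Proof.
move=> [fin _]; exists (fine (sup_norm sigma)) => n.
have h k : ((modulus (sigma k))%:E <= sup_norm sigma)%E.
  by apply: ereal_sup_ubound; exists k.
rewrite -lee_fin fineK ?h// ge0_fin_numE//.
by apply: le_trans (h 0%N); rewrite lee_fin; apply: le_trans (Re_le_modulus _).
Qed.

(** Convergence of [omega] to [0] makes it finite near [0], so a single positive [d] with
    [omega sigma d <= e] can be extracted. *)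
Lemma RO_modulus sigma e : @RO R sigma -> 0 < e -> exists2 delta, 0 < delta &
  forall m n, rho R m n <= delta -> modulus (sigma n - sigma m) <= e.
Proof.
move=> [_ /fine_cvgP[ffin f0]] e0.
have : \forall d \near 0^'+, 0 < d /\ (omega sigma d <= e%:E)%E.
  near=> d; split; first by near: d; exact: nbhs_right_gt.
  have dfin : omega sigma d \is a fin_num by near: d.
  rewrite -(fineK dfin) lee_fin; near: d.
  by apply: (cvgr_le _ f0).
move=> /filter_ex[d [d0 de]]; exists d => // m n mn.
rewrite -lee_fin; apply: le_trans de.
by apply: ereal_sup_ubound; exists (m, n).
Unshelve. all: by end_near. Qed.

Lemma Linfty_approximation sigma eps : @RO R sigma -> 0 < eps ->
  exists2 a, @Linfty R a & forall n, modulus (sigma n - gamma_seq a n) <= eps.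
Proof.
move=> sRO e0; have [C sC] := RO_bounded sRO.
have e2 : 0 < eps / 2 by rewrite divr_gt0.
have [g1 [C1 g1b] h1] : exists2 g, is_bounded g &
    forall n, `|complex.Re (sigma n) - heat 1 g n| <= eps / 2.
  apply: (@heat_dense_in_RO _ _ C) => // [n|e e'0].
    exact: le_trans (Re_le_modulus _) (sC n).
  have [d d0 hd] := RO_modulus sRO e'0; exists d => // m k mk.
  by rewrite distrC -ReB (le_trans (Re_le_modulus _))// hd.
have [g2 [C2 g2b] h2] : exists2 g, is_bounded g &
    forall n, `|complex.Im (sigma n) - heat 1 g n| <= eps / 2.
  apply: (@heat_dense_in_RO _ _ C) => // [n|e e'0].
    exact: le_trans (Im_le_modulus _) (sC n).
  have [d d0 hd] := RO_modulus sRO e'0; exists d => // m k mk.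
  by rewrite distrC -ImB (le_trans (Im_le_modulus _))// hd.
have msq : measurable_fun (@Rplus R) (fun x : R => x ^+ 2) by apply: measurable_funX.
(* The square undoes the [sqrt r] in [gamma_seq], so that [heat1_husimi] applies to each
   component. *)
pose a (x : R) : R[i] := husimi g1 (x ^+ 2) +i* husimi g2 (x ^+ 2).
exists a.
  split.
  - by apply: (measurable_husimi g1b msq) => r _; exact: sqr_ge0.
  - by apply: (measurable_husimi g2b msq) => r _; exact: sqr_ge0.
  - exists (C1 + C2); apply: aeW => r _; apply: (le_trans (modulus_le _)).
    by apply: lerD; apply: husimi_bounded => //; exact: sqr_ge0.
have eg g D n : bounded_by D g -> n`!%:R^-1 * \int[mu]_(r in @Rplus R)
    (husimi g (Num.sqrt r ^+ 2) * (expR (- r) * r ^+ n)) = heat 1 g n.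
  move=> gD; rewrite (heat1_husimi _ gD) -(@gamma_meanE _ D).
  - congr (_ * _); apply: eq_Rintegral => r; rewrite inE RplusE => r0.
    by rewrite sqr_sqrtr.
  - exact: (@measurable_husimi _ g D id).
  - by move=> r r0; exact: husimi_bounded.
move=> n; apply: (le_trans (modulus_le _)).
rewrite ReB ImB Re_gamma_seq Im_gamma_seq /= (eg _ _ _ g1b) (eg _ _ _ g2b).
by rewrite [leRHS]splitr lerD.
Qed.

End Theorem7p3.

Theorem theorem7p3 (R : realType) : sup_dense_subset (@frakG R) (@RO R).
Proof.
split=> [|sigma sRO eps e0]; first exact: frakG_subset_RO.
(* A pointwise bound passes to the supremum only as a weak inequality; [eps / 2] makes it strict. *)
have e2 : 0 < eps / 2 by rewrite divr_gt0.
have [a aL h] := Linfty_approximation sRO e2.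
exists (gamma_seq a); first by exists a.
apply: (@le_lt_trans _ _ (eps / 2)%:E).
  by apply: ge_ereal_sup => _ [n _ <-]; rewrite lee_fin.
by rewrite lte_fin ltr_pdivrMr// ltr_pMr// ltr1n.
Qed.
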